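(* Let $T>0$, let $X$ and $Y$ be independent copies of a stationary centered Gaussian process on $[0,T]$ with unit variance and continuously differentiable sample paths, let $\rho\in(-1,1)$ be a fixed constant, and define $$X_1=X,\qquad X_2=\rho X+\sqrt{1-\rho^2}\,Y.$$ Then for every real $u>0$, $$\mathrm{P}\left(\max_{t\in[0,T]}\min\{X_1(t),X_2(t)\}\ge u\right)\le 2\int_u^\infty\varphi(x)\,\overline{\Phi}\left(\sqrt{\frac{1-\rho}{1+\rho}}\,x\right)dx+2T\varphi(u)\frac{\sqrt{\mathrm{Var}(X_1'(0))}}{\sqrt{2\pi}}\,\overline{\Phi}\left(\sqrt{\frac{1-\rho}{1+\rho}}\,u\right).$$
   Context: $\varphi(x)=\frac{1}{\sqrt{2\pi}}e^{-x^2/2}$ is the standard normal density and $\overline{\Phi}(x)=\int_x^\infty\varphi(y)\,dy$ is the standard normal tail function. $X_1'$ denotes the derivative of the sample paths of $X_1$. *)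

(* Defs.v *)
From HB Require Import structures.
From mathcomp Require Import all_boot all_order all_algebra.
From mathcomp Require Import all_classical all_reals all_analysis.

Set Implicit Arguments.
Unset Strict Implicit.
Unset Printing Implicit Defensive.

Import Order.TTheory GRing.Theory Num.Theory.
Import numFieldNormedType.Exports.

Local Open Scope classical_set_scope.
Local Open Scope ring_scope.

Definition std_normal_pdf {R : realType} (x : R) : R := normal_pdf 0 1 x.

Lemma std_normal_pdfE (R : realType) (x : R) :
  std_normal_pdf x = (Num.sqrt (2 * pi))^-1 * expR (- x ^+ 2 / 2).
Proof.
rewrite /std_normal_pdf normal_pdfE ?oner_neq0// /normal_peak /normal_fun.
by rewrite subr0 expr1n mul1r mulr_natl.
Qed.

Definition std_normal_tail {R : realType} (x : R) : R :=
  \int[lebesgue_measure]_(y in `[x, +oo[) std_normal_pdf y.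

(* The degenerate case is stated apart because [normal_pdf m 0] is, by
   convention, the density of the uniform law on [0, 1]. *)
Definition gaussian_law {R : realType} (mu : set R -> \bar R) : Prop :=
  (exists m s : R, 0 < s /\
     forall B : set R, measurable B -> mu B = normal_prob m s B) \/
  (exists m : R, forall B : set R, measurable B -> mu B = \d_m B).

(* A process on [0, T] is a family of random variables indexed by all of R, of
   which only the members with index in [0, T] are ever constrained or used. *)
Section processes.
Context {d : measure_display} {Omega : measurableType d} {R : realType}
  {P : probability Omega R}.
Implicit Types (T : R) (X Y : R -> {RV P >-> R}).

Definition fdd X n (t : n.-tuple R) : set (n.-tuple R) -> \bar R :=
  pushforward P (fun w : Omega => [tuple X (tnth t i) w | i < n]).

Definition same_fdd T X Y : Prop :=
  forall n (t : n.-tuple R), (forall i, 0 <= tnth t i <= T) ->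
  forall B : set (n.-tuple R), measurable B -> fdd X t B = fdd Y t B.

Definition stationary T X : Prop :=
  forall n (t : n.-tuple R) (h : R),
  (forall i, 0 <= tnth t i <= T) -> (forall i, 0 <= tnth t i + h <= T) ->
  forall B : set (n.-tuple R), measurable B ->
    fdd X [tuple tnth t i + h | i < n] B = fdd X t B.

Definition gaussian_process T X : Prop :=
  forall n (t a : n.-tuple R), (forall i, 0 <= tnth t i <= T) ->
  gaussian_law (pushforward P
    (fun w : Omega => \sum_(i < n) tnth a i * X (tnth t i) w)).

Definition centered T X : Prop :=
  forall t, 0 <= t <= T -> ('E_P[X t] = 0)%E.

Definition unit_variance T X : Prop :=
  forall t, 0 <= t <= T -> ('V_P[X t] = 1)%E.

Definition path_sigma_algebra T X : set (set Omega) :=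
  <<s [set A | exists t (B : set R),
         [/\ 0 <= t <= T, measurable B & A = X t @^-1` B] ]>>.

Definition independent_processes T X Y : Prop :=
  forall A B, path_sigma_algebra T X A -> path_sigma_algebra T Y B ->
  P (A `&` B) = (P A * P B)%E.

End processes.

(* The increments are taken inside [0, T], so the derivative is one-sided at
   the two endpoints. *)
Definition diff_quot_within {R : realType} (T : R) (f : R -> R) (t : R) :=
  (fun s => (f s - f t) / (s - t)) @ within `[0, T] t^'.

Definition path_derivative {R : realType} (T : R) (f : R -> R) (t : R) : R :=
  lim (diff_quot_within T f t).

Definition C1_path {R : realType} (T : R) (f : R -> R) : Prop :=
  (forall t, 0 <= t <= T -> cvg (diff_quot_within T f t)) /\
  {within `[0, T], continuous (path_derivative T f)}.

(* For a continuous path this supremum is attained. *)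
Definition path_max {R : realType} (T : R) (f : R -> R) : R :=
  sup (f @` `[0, T]).

Definition std_C1_stationary_gaussian {d : measure_display}
    {Omega : measurableType d} {R : realType} {P : probability Omega R}
    (T : R) (X : R -> {RV P >-> R}) : Prop :=
  [/\ gaussian_process T X, stationary T X, centered T X, unit_variance T X &
      forall w, C1_path T (fun t => X t w)].

(* Main.v *)
Require Import Defs.
From HB Require Import structures.
From mathcomp Require Import all_boot all_order all_algebra.
From mathcomp Require Import all_classical all_reals all_analysis.
From mathcomp Require Import measurable_realfun ring lra.
Set Implicit Arguments.
Unset Strict Implicit.
Unset Printing Implicit Defensive.
Import Order.TTheory GRing.Theory Num.Theory.
Import numFieldNormedType.Exports.
Local Open Scope classical_set_scope.
Local Open Scope ring_scope.

(** Write phi for the standard normal density, c for sqrt ((1 - rho) / (1 + rho)), and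
M for min (X1, X2). Paths are continuous, so M exceeds a level v at some time if and
only if it does so at a point of some dyadic grid, of mesh h = T / 2^m. On a grid,
either M(0) > v, or M passes from below v to above v in some step from s to t = s + h;
in the latter case one of X1, X2 is at most v at time s, while both exceed v at time t.
A union bound over the steps is therefore enough.

The start. M(0) > v is covered by v < X1 <= X2 and v < X2 <= X1. Since X2 is
rho X1 + sqrt (1 - rho^2) Y with Y independent of X1, the first event has probability
exactly the integral of phi(x) Phibar(c x) over x >= v, and (X2, X1) is the image of an
independent pair under the same map ([joint_exceedance_prob]).

A step. Let r = E X(s) X(t). The variables V = X1(t), W = (r V - X1(s)) / sqrt (1 - r^2)
and Z = Y(t) are independent standard normal. The step requires v < V <= v + l(W), with
l(W) = ((1 - r) v + sqrt (1 - r^2) W^+) / r, and then X2(t) > v forces Z > c v - k l(W)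
for a constant k. The density of V is at most phi(v) on that interval, so given W the
probability is at most phi(v) l(W) (Phibar(c v) + k l(W)); as E W^+ = 1 / sqrt (2 pi),
the mean over W is
  phi(v) Phibar(c v) sqrt (1 - r^2) / sqrt (2 pi) + O(h^2)
([crossing_set_prob], [crossing_prob]). The bound for X2 is the same, by the rotation
taking (X, Y) to (X2, sqrt (1 - rho^2) X - rho Y). By stationarity r depends on h only,
and 2 (1 - r) / h^2, the variance of (X(h) - X(0)) / h, tends to a number at most
Var X'(0) ([increment_variance_cvg]), so the sum over the T / h steps, counted for both
components, tends to at most the second term of the bound ([cvg_crossing_bound]).

Finally {max M >= u} is contained in {max M > v} for every v < u, and the bound is
continuous in the level ([joint_bound_le_limit]).

Independence and limits of laws are both obtained from the integrals of cos (a U + b):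
a bounded weight g for which E [g cos (a U + b)] is kappa exp (- a^2 / 2) cos b for all a, b
satisfies E [g 1_B(U)] = kappa P(N in B) with N standard normal
([normal_weighted_law]), because indicators of rays are bounded
pointwise limits of trigonometric polynomials. *)

(** * The normal law and its affine images *)

(** Rays form a pi-system generating the Borel sets, so this is Dynkin induction. *)
Lemma borel_induction (R : realType) (Q : set R -> Prop) :
  Q setT -> (forall c, Q `]c, +oo[%classic) ->
  (forall B, measurable B -> Q B -> Q (~` B)) ->
  (forall F : (set R)^nat, (forall n, measurable (F n)) ->
     trivIset setT F -> (forall n, Q (F n)) -> Q (\bigcup_k F k)) ->
  forall B : set R, measurable B -> Q B.
Proof.
move=> QT Qray QC QU B mB.
have mE : @measurable _ (measurableTypeR R) = <<s @RGenOInfty.G R >>.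
  exact: RGenOInfty.measurableE.
have {mB} : (<<s @RGenOInfty.G R >>) B by rewrite -mE.
apply: (@dynkin_induction _ (measurableTypeR R) (@RGenOInfty.G R) Q mE) => //.
- move=> _ _ [x ->] [y ->]; exists (Num.max x y).
  by apply/seteqP; split=> z /=; rewrite !in_itv/= !andbT gt_max => /andP.
- by move=> _ [x ->]; exact: Qray.
Qed.

Lemma prob_eq_rays (R : realType) (m1 m2 : probability (measurableTypeR R) R) :
  (forall c, m1 `]c, +oo[%classic = m2 `]c, +oo[%classic) ->
  forall B : set R, measurable B -> m1 B = m2 B.
Proof.
move=> m12; apply: borel_induction => //.
- by rewrite !probability_setT.
- by move=> B mB QB; rewrite !probability_setC// QB.
- move=> F mF tF QF; rewrite !measure_bigcup//; try by move=> i _; exact: mF.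
  by apply: eq_eseriesr => n _; exact: QF.
Qed.

Section normal_facts.
Context {R : realType}.
Local Notation leb := (@lebesgue_measure R).

(** The normal density is almost everywhere the Radon-Nikodym derivative of the law,
since both have the same integral over every measurable set. *)
Lemma ge0_integral_normal_prob (m s : R) (f : R -> \bar R) :
  measurable_fun [set: R] f -> (forall x, 0 <= f x)%E ->
  (\int[normal_prob m s]_x f x = \int[leb]_x (f x * (normal_pdf m s x)%:E))%E.
Proof.
move=> mf f0.
have mp : measurable_fun [set: measurableTypeR R]
    (fun x => (normal_pdf m s x)%:E).
  by apply/measurable_EFinP; exact: measurable_normal_pdf.
rewrite -(Radon_Nikodym_SigmaFinite.change_of_variables
  (normal_prob_dominates m s) f0 measurableT mf).
apply: ae_eq_integral => //.
- apply: emeasurable_funM => //; apply: (measurable_int leb).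
  exact/Radon_Nikodym_SigmaFinite.f_integrable/normal_prob_dominates.
- exact: emeasurable_funM.
- apply: ae_eqe_mul2l; apply: integral_ae_eq => //.
  + exact/Radon_Nikodym_SigmaFinite.f_integrable/normal_prob_dominates.
  + move=> E _ mE.
    by rewrite -Radon_Nikodym_SigmaFinite.f_integral//;
      exact: normal_prob_dominates.
Qed.

Lemma normal_probE (m s : R) (B : set R) :
  normal_prob m s B = (\int[leb]_(x in B) (normal_pdf m s x)%:E)%E.
Proof. by []. Qed.

Lemma normal_pdf_affine (m s y : R) : 0 < s ->
  normal_pdf m s (m + s * y) * s = normal_pdf 0 1 y.
Proof.
move=> s0; rewrite !normal_pdfE ?oner_neq0 ?gt_eqF// /normal_peak /normal_fun.
rewrite subr0 addrAC subrr add0r expr1n mul1r.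
rewrite -mulrnAr sqrtrM ?sqr_ge0// sqrtr_sqr gtr0_norm// invfM.
rewrite mulrAC [_ / _]mulrC mulfVK ?gt_eqF//; congr (_ * expR _).
by field; rewrite gt_eqF.
Qed.

Lemma normal_prob_affine (m s : R) (B : set R) : 0 < s -> measurable B ->
  normal_prob m s B = normal_prob 0 1 [set y | B (m + s * y)].
Proof.
move=> s0 mB.
have mphi : measurable_fun [set: measurableTypeR R]
    ((fun y : R => m + s * y) : measurableTypeR R -> measurableTypeR R).
  by apply: measurable_funD => //; exact: measurable_funM.
pose phi : {mfun measurableTypeR R >-> measurableTypeR R} :=
  HB.pack (fun y : R => m + s * y) (isMeasurableFun.Build _ _ _ _ _ mphi).
apply: (@prob_eq_rays _ (normal_prob m s)
  (distribution (normal_prob 0 1) phi) _ B mB) => c.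
pose a := (c - m) / s.
have ca : c = m + s * a by rewrite /a mulrC divfK ?gt_eqF// addrC subrK.
rewrite /distribution /pushforward/= (_ : _ @^-1` _ = `]a, +oo[%classic); last first.
  apply/seteqP; split=> y /=; rewrite !in_itv/= !andbT ca.
    by rewrite ltrD2l ltr_pM2l.
  by rewrite ltrD2l ltr_pM2l.
have dphi : (fun y : R => m + s * y)^`()%classic = cst s.
  apply/funext => y; rewrite derive1E deriveD// deriveM// !derive_cst.
  by rewrite derive_id scaler0 addr0 add0r /GRing.scale/= mulr1.
rewrite !normal_probE !integral_itv_obnd_cbnd; last 2 first.
- by apply/measurable_funTS/measurable_EFinP; exact: measurable_normal_pdf.
- by apply/measurable_funTS/measurable_EFinP; exact: measurable_normal_pdf.
rewrite ca (@increasing_ge0_integration_by_substitutiony _ (fun y : R => m + s * y)).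
- apply: eq_integral => y _; congr EFin.
  by rewrite dphi -(normal_pdf_affine m y s0).
- by move=> x y _ _ xy; rewrite ltrD2l ltr_pM2l.
- by rewrite dphi => x _; exact: cvg_cst.
- by rewrite dphi; exact: is_cvg_cst.
- by rewrite dphi; exact: is_cvg_cst.
- split => //.
  apply: cvg_at_right_filter; apply: cvgD; first exact: cvg_cst.
  by apply: cvgM; [exact: cvg_cst|exact: cvg_id].
- rewrite (_ : (fun y => _) = (fun y => y * s + m)); last first.
    by apply/funext => y; rewrite addrC mulrC.
  apply: (@cvg_comp _ _ _ (fun y => y * s) (fun y => y + m) _ +oo); last exact: cvg_addrr.
  by apply/gt0_cvgMly => //; exact: cvg_id.
- by apply: continuous_subspaceT; apply: continuous_normal_pdf; rewrite gt_eqF.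
- by move=> x _; exact: normal_pdf_ge0.
Qed.

End normal_facts.

(** * Stein identity for the standard normal density *)

Section Rintegral_facts.
Context d {T : measurableType d} {R : realType} (m : {measure set T -> \bar R}).
Implicit Types f g : T -> R.

Lemma integrable_dominated f g : measurable_fun [set: T] f ->
  (forall x, `|f x| <= g x) -> m.-integrable [set: T] (EFin \o g) ->
  m.-integrable [set: T] (EFin \o f).
Proof.
move=> mf fg; apply: le_integrable => //; first exact/measurable_EFinP.
by move=> x _ /=; rewrite lee_fin (le_trans (fg x))// ler_norm.
Qed.

Lemma cvg_Rintegral_dominated (f_ : nat -> T -> R) f g :
  (forall n, measurable_fun [set: T] (f_ n)) ->
  (forall x, f_ n x @[n --> \oo] --> f x) ->
  (forall n x, `|f_ n x| <= g x) -> m.-integrable [set: T] (EFin \o g) ->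
  (\int[m]_x f_ n x) @[n --> \oo] --> \int[m]_x f x.
Proof.
move=> mf_ f_f f_g ig.
have mf : measurable_fun [set: T] f.
  by apply: (measurable_fun_cvg mf_) => // x _; exact: f_f.
have [| | | | |fint _ cv] := @dominated_convergence _ _ _ m setT measurableT
  (fun n => EFin \o f_ n) (EFin \o f) (EFin \o g).
- by move=> n; exact/measurable_EFinP.
- exact/measurable_EFinP.
- by apply: aeW => x _ /=; apply: cvg_EFin; [exact: nearW|exact: f_f].
- exact: ig.
- by apply: aeW => x n _ /=; rewrite lee_fin.
- by apply: fine_cvg; rewrite fineK//; exact: integrable_fin_num.
Qed.

End Rintegral_facts.

Section std_normal.
Context {R : realType}.
Local Notation leb := (@lebesgue_measure R).
Local Notation phi := (@std_normal_pdf R).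
Local Notation gam := (@normal_prob R 0 1).

Lemma std_normal_pdf_ge0 x : 0 <= phi x.
Proof. exact: normal_pdf_ge0. Qed.

Lemma std_normal_pdf0_le1 : (Num.sqrt (2 * pi))^-1 <= 1 :> R.
Proof.
have h : (1:R) <= Num.sqrt (2 * pi).
  rewrite -[leLHS]sqrtr1 ler_sqrt ?mulr_ge0 ?pi_ge0//.
  by have := @pi_ge2 R; lra.
by rewrite invf_le1// (lt_le_trans ltr01).
Qed.

Lemma std_normal_pdf_le_expR x : phi x <= expR (- x ^+ 2 / 2).
Proof.
by rewrite std_normal_pdfE ler_piMl ?expR_ge0//; exact: std_normal_pdf0_le1.
Qed.

Lemma std_normal_pdf_le1 x : phi x <= 1.
Proof.
rewrite (le_trans (std_normal_pdf_le_expR x))// -expR0 ler_expR.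
by rewrite mulNr oppr_le0 divr_ge0// sqr_ge0.
Qed.

Lemma is_derive_std_normal_pdf (x : R) : is_derive x 1 phi (- (x * phi x)).
Proof.
have -> : phi = (fun x => (Num.sqrt (2 * pi))^-1 * expR (- x ^+ 2 / 2)).
  by apply/funext => y; rewrite std_normal_pdfE.
apply: is_derive_eq.
rewrite /GRing.scale/=; set k := (Num.sqrt _)^-1; set e := expR _.
by field.
Qed.

Lemma continuous_std_normal_pdf : continuous phi.
Proof. by apply: continuous_normal_pdf; rewrite oner_neq0. Qed.

Lemma measurable_std_normal_pdf : measurable_fun [set: R] phi.
Proof. exact: measurable_normal_pdf. Qed.

(** Dominates every function of at most quadratic growth against the normal law. *)
Lemma integrable_sqr_std_normal_pdf :
  leb.-integrable [set: R] (EFin \o (fun x => (1 + x ^+ 2) * phi x)).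
Proof.
have s2 : Num.sqrt 2 != 0 :> R by rewrite gt_eqF// sqrtr_gt0.
have k0 := normal_peak_gt0 s2.
(* 1 + x^2 is at most 5 exp (x^2 / 4), which leaves a multiple of the N(0, 2) density. *)
apply: (@integrable_dominated _ (measurableTypeR R) R leb _
    (fun x => 5 / normal_peak (Num.sqrt 2) * normal_pdf 0 (Num.sqrt 2) x)).
- apply: measurable_funM; last exact: measurable_std_normal_pdf.
  by apply: measurable_funD => //; exact: measurable_funX.
- move=> x; rewrite ger0_norm; last first.
    by rewrite mulr_ge0 ?std_normal_pdf_ge0// addr_ge0 ?sqr_ge0.
  rewrite normal_pdfE// mulrA divfK ?gt_eqF// /normal_fun subr0 sqr_sqrtr//.
  rewrite (_ : 2 *+ 2 = 4)//; last by rewrite -mulr_natl; ring.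
  have h := std_normal_pdf_le_expR x.
  have -> : - x ^+ 2 / 4 = - x ^+ 2 / 2 + x ^+ 2 / 4 by field.
  rewrite expRD mulrCA.
  apply: (@le_trans _ _ ((1 + x ^+ 2) * expR (- x ^+ 2 / 2))).
    by rewrite ler_wpM2l// addr_ge0 ?sqr_ge0.
  rewrite mulrC ler_wpM2l ?expR_ge0//.
  have := @expR_ge1Dx R (x ^+ 2 / 4).
  have := @expR_ge0 R (x ^+ 2 / 4).
  have := sqr_ge0 x.
  have : 1 <= expR (x ^+ 2 / 4) by rewrite -expR0 ler_expR divr_ge0 ?sqr_ge0.
  lra.
- have := @integrable_normal_pdf R 0 (Num.sqrt 2).
  move/(integrableZl measurableT (5 / normal_peak (Num.sqrt 2))).
  by apply: eq_integrable => // x _ /=; rewrite EFinM.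
Qed.

(** Stein identity: the function f phi has derivative (f' - x f) phi and vanishes at
infinity, f being of at most linear growth. *)
Lemma std_normal_by_parts (f f' : R -> R) (C : R) :
  (forall x : R, is_derive x 1 f (f' x)) -> continuous f' ->
  (forall x, `|f x| <= C * (1 + `|x|)) -> (forall x, `|f' x| <= C * (1 + `|x|)) ->
  \int[leb]_x (f' x * phi x) = \int[leb]_x (x * f x * phi x).
Proof.
move=> df cf' fC f'C.
have cf : continuous f.
  move=> x; apply/differentiable_continuous/derivable1_diffP.
  by have [] := df x.
have C0 : 0 <= C by have := le_trans (normr_ge0 _) (fC 0); rewrite normr0 addr0 mulr1.
pose F x := f x * phi x.
pose h x := f' x * phi x - x * f x * phi x.
have dF (x : R) : is_derive x 1 F (h x).
  have d1 := df x; have d2 := is_derive_std_normal_pdf x.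
  apply: is_derive_eq; rewrite /h /GRing.scale/=; ring.
have c1 : continuous (fun x : R => f' x * phi x).
  by move=> x; apply: cvgM; [exact: cf'|exact: continuous_std_normal_pdf].
have c2 : continuous (fun x : R => x * f x * phi x).
  move=> x; apply: cvgM; last exact: continuous_std_normal_pdf.
  by apply: cvgM; [exact: cvg_id|exact: cf].
have ch : continuous h by move=> x; apply: cvgB; [exact: c1|exact: c2].
have iG : leb.-integrable [set: R] (EFin \o (fun x => 4 * C * ((1 + x ^+ 2) * phi x))).
  have /(integrableZl measurableT (4 * C)) := integrable_sqr_std_normal_pdf.
  by apply: eq_integrable => // x _ /=; rewrite EFinM.
have bnd x (y : R) : `|y| <= C * (1 + `|x|) ->
    `|y * phi x| <= 2 * C * ((1 + x ^+ 2) * phi x) /\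
    `|x * y * phi x| <= 2 * C * ((1 + x ^+ 2) * phi x).
  move=> yC; have p0 := std_normal_pdf_ge0 x.
  have x0 := normr_ge0 x; have xx : x ^+ 2 = `|x| ^+ 2 by rewrite real_normK ?num_real.
  have y0 := normr_ge0 y.
  rewrite !normrM (ger0_norm p0) !mulrA; split; apply: ler_wpM2r => //; rewrite xx.
    have : C * (1 + `|x|) <= C * (2 * (1 + `|x| ^+ 2)) by rewrite ler_wpM2l//; nra.
    lra.
  have : C * (`|x| * (1 + `|x|)) <= C * (2 * (1 + `|x| ^+ 2)).
    by rewrite ler_wpM2l//; nra.
  have := ler_wpM2l x0 yC; lra.
have i1 : leb.-integrable [set: R] (EFin \o (fun x => f' x * phi x)).
  apply: (@integrable_dominated _ (measurableTypeR R) R leb _ _ _ _ iG); first exact: continuous_measurable_fun.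
  move=> x; have [h1 _] := bnd x _ (f'C x); apply: (le_trans h1).
  apply: ler_wpM2r; last lra.
  by rewrite mulr_ge0 ?std_normal_pdf_ge0// addr_ge0 ?sqr_ge0.
have i2 : leb.-integrable [set: R] (EFin \o (fun x => x * f x * phi x)).
  apply: (@integrable_dominated _ (measurableTypeR R) R leb _ _ _ _ iG); first exact: continuous_measurable_fun.
  move=> x; have [_ h1] := bnd x _ (fC x); apply: (le_trans h1).
  apply: ler_wpM2r; last lra.
  by rewrite mulr_ge0 ?std_normal_pdf_ge0// addr_ge0 ?sqr_ge0.
have hbnd x : `|h x| <= 4 * C * ((1 + x ^+ 2) * phi x).
  rewrite (le_trans (ler_normB _ _))//.
  have [h1 _] := bnd x _ (f'C x); have [_ h2] := bnd x _ (fC x).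
  by move: h1 h2; set z := (X in _ * X); lra.
apply/eqP; rewrite -subr_eq0 -RintegralB//; apply/eqP.
pose I n := `[- n.+1%:R, n.+1%:R]%classic : set R.
(* The integral of h over the whole line is the limit of its integrals over the
   intervals from - (n + 1) to n + 1, each given by the values of F at the endpoints. *)
have cv1 : (\int[leb]_x ((h \_ (I n)) x)) @[n --> \oo] --> \int[leb]_x h x.
  apply: (@cvg_Rintegral_dominated _ (measurableTypeR R) R leb _ _ _ _ _ _ iG).
  - move=> n; have mI : measurable (I n) by exact: measurable_itv.
    rewrite patch_indic; apply: measurable_funM.
      exact: continuous_measurable_fun.
    exact: (@measurable_indic _ (measurableTypeR R)).
  - move=> x; apply: cvg_near_cst; near=> n.
    rewrite /I patchE mem_set//=; rewrite in_itv/= -ler_norml.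
    rewrite (@le_trans _ _ n%:R)// ?ler_nat//.
    by near: n; exact: nbhs_infty_ger.
  - move=> n x; rewrite patchE; case: ifPn => // _; rewrite normr0.
    by rewrite mulr_ge0 ?mulr_ge0 ?std_normal_pdf_ge0// addr_ge0 ?sqr_ge0.
have E n : \int[leb]_x ((h \_ (I n)) x) = F n.+1%:R - F (- n.+1%:R).
  rewrite -Rintegral_mkcond /Rintegral (@continuous_FTC2 _ h F)//.
  - by rewrite gtrN// ltr0n.
  - exact: continuous_subspaceT.
  - split.
    + by move=> x _; have [] := dF x.
    + apply: cvg_at_right_filter.
      by apply: cvgM; [exact: cf|exact: continuous_std_normal_pdf].
    + apply: cvg_at_left_filter.
      by apply: cvgM; [exact: cf|exact: continuous_std_normal_pdf].
  - by move=> x _; rewrite derive1E; have [_ ->] := dF x.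
(* (1 + |x|)^2 is at most 4 (1 + x^2 / 2), hence at most 4 exp (x^2 / 2). *)
have Fle x : `|F x| <= C * 4 / (1 + `|x|).
  rewrite /F normrM (ger0_norm (std_normal_pdf_ge0 x)).
  apply: (@le_trans _ _ (C * (1 + `|x|) * expR (- x ^+ 2 / 2))).
    by apply: ler_pM => //; [exact: std_normal_pdf_ge0|exact: std_normal_pdf_le_expR].
  have x0 := normr_ge0 x; have xx : x ^+ 2 = `|x| ^+ 2 by rewrite real_normK ?num_real.
  rewrite -!mulrA ler_wpM2l// mulNr expRN ler_pdivlMr ?ltr_pwDl//.
  rewrite mulrAC ler_pdivrMr ?expR_gt0//.
  have := @expR_ge1Dx R (x ^+ 2 / 2); rewrite xx; nra.
have cv2 : (F n.+1%:R - F (- n.+1%:R)) @[n --> \oo] --> (0:R).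
  apply/norm_cvg0P.
  apply: (@squeeze_cvgr _ _ _ _ (cst 0) (fun n => C * 8 * (n.+1%:R)^-1)).
  - apply: nearW => n; rewrite normr_ge0/= (le_trans (ler_normB _ _))//.
    have := Fle n.+1%:R; have := Fle (- n.+1%:R).
    rewrite normrN normr_nat => h1 h2; apply: (le_trans (lerD h2 h1)).
    have iv : (1 + n.+1%:R)^-1 <= n.+1%:R^-1 :> R.
      by rewrite lef_pV2 ?posrE ?ltr_pwDl// lerDr.
    have {iv} := ler_wpM2l C0 iv.
    by move: (_^-1) (_^-1) => a b; lra.
  - exact: cvg_cst.
  - rewrite -[X in _ --> X](mulr0 (C * 8)); apply: cvgMr; exact: cvg_harmonic.
move: cv1; under eq_fun do rewrite E.
by move/cvg_unique; exact.
Unshelve. all: end_near. Qed.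

End std_normal.

(** * Integrals against the standard normal law *)

Section std_normal_integrals.
Context {R : realType}.
Local Notation leb := (@lebesgue_measure R).
Local Notation phi := (@std_normal_pdf R).
Local Notation gam := (@normal_prob R 0 1).

Lemma integral_std_normal (f : R -> R) : measurable_fun [set: R] f ->
  (\int[gam]_x (f x)%:E = \int[leb]_x (f x * phi x)%:E)%E.
Proof.
move=> mf; have mfE : measurable_fun [set: R] (EFin \o f) by exact/measurable_EFinP.
rewrite integralE [in RHS]integralE; congr (_ - _)%E.
- rewrite ge0_integral_normal_prob//; last exact: measurable_funepos.
  apply: eq_integral => x _ /=; rewrite !funeposE/= -[in RHS]EFin_max -[in LHS]EFin_max.
  by rewrite -EFinM maxr_pMl ?std_normal_pdf_ge0// mul0r.
- rewrite ge0_integral_normal_prob//; last exact: measurable_funeneg.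
  apply: eq_integral => x _ /=; rewrite !funenegE/= -[in RHS]EFin_max -[in LHS]EFin_max.
  by rewrite -EFinM maxr_pMl ?std_normal_pdf_ge0// mul0r mulNr.
Qed.

Lemma Rintegral_std_normal (f : R -> R) : measurable_fun [set: R] f ->
  \int[gam]_x f x = \int[leb]_x (f x * phi x).
Proof. by move=> mf; rewrite /Rintegral integral_std_normal. Qed.

Lemma integrable_std_normal (f : R -> R) : measurable_fun [set: R] f ->
  leb.-integrable [set: R] (EFin \o (fun x => f x * phi x)) ->
  gam.-integrable [set: R] (EFin \o f).
Proof.
move=> mf /integrableP[_ fin]; apply/integrableP; split.
  exact/measurable_EFinP.
apply: le_lt_trans fin; rewrite le_eqVlt; apply/orP; left; apply/eqP.
rewrite [LHS](integral_std_normal (f := fun x => `|f x|)).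
  by apply: eq_integral => x _ /=; rewrite normrM (ger0_norm (std_normal_pdf_ge0 x)).
exact: measurableT_comp.
Qed.

Lemma integrable_std_normal_sqr (f : R -> R) (C : R) : measurable_fun [set: R] f ->
  (forall x, `|f x| <= C * (1 + x ^+ 2)) ->
  leb.-integrable [set: R] (EFin \o (fun x => f x * phi x)) /\
  gam.-integrable [set: R] (EFin \o f).
Proof.
move=> mf fC.
have i1 : leb.-integrable [set: R] (EFin \o (fun x => f x * phi x)).
  apply: (@integrable_dominated _ (measurableTypeR R) R leb _
    (fun x => C * ((1 + x ^+ 2) * phi x))).
  - by apply: measurable_funM => //; exact: measurable_std_normal_pdf.
  - move=> x; rewrite normrM (ger0_norm (std_normal_pdf_ge0 x)) mulrA.
    by rewrite ler_wpM2r// std_normal_pdf_ge0.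
  - have /(integrableZl measurableT C) := @integrable_sqr_std_normal_pdf R.
    by apply: eq_integrable => // x _ /=; rewrite EFinM.
by split => //; exact: integrable_std_normal.
Qed.

(** Stein identity for the constant function 1. *)
Lemma mean_std_normal : \int[gam]_x x = 0.
Proof.
rewrite Rintegral_std_normal//.
have := @std_normal_by_parts R (cst 1) (cst 0) 1.
rewrite /cst; under [X in _ -> _ -> _ -> _ -> X = _]eq_Rintegral do rewrite mul0r.
under [X in _ -> _ -> _ -> _ -> _ = X]eq_Rintegral do rewrite mulr1.
rewrite /cst Rintegral_cst//= mul0r => <-//.
- by move=> x; exact: cvg_cst.
- by move=> x; rewrite normr1 mul1r lerDl.
- by move=> x; rewrite normr0 mul1r addr_ge0.
Qed.

(** Stein identity for the identity function. *)
Lemma second_moment_std_normal : \int[gam]_x (x ^+ 2) = 1.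
Proof.
rewrite Rintegral_std_normal; last exact: measurable_funX.
have := @std_normal_by_parts R id (cst 1) 1.
rewrite /cst; under [X in _ -> _ -> _ -> _ -> X = _]eq_Rintegral do rewrite mul1r.
under [X in _ -> _ -> _ -> _ -> _ = X]eq_Rintegral do rewrite -expr2.
move=> <-.
- by rewrite /Rintegral (integral_normal_pdf 0 1).
- by move=> x; exact: cvg_cst.
- by move=> x; rewrite mul1r lerDr.
- by move=> x; rewrite normr1 mul1r lerDl.
Qed.

Lemma std_normal_pdf0 : phi 0 = (Num.sqrt (2 * pi))^-1.
Proof. by rewrite std_normal_pdfE expr0n oppr0 mul0r expR0 mulr1. Qed.

(** On the positive half-line x phi(x) is the derivative of - phi. *)
Lemma mean_pos_part_std_normal :
  (\int[gam]_x (Num.max x 0)%:E = ((Num.sqrt (2 * pi))^-1)%:E)%E.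
Proof.
rewrite integral_std_normal; last exact: measurable_funrpos.
have -> : (fun x : R => (Num.max x 0 * phi x)%:E) =
    (EFin \o (fun x => x * phi x)) \_ `[0, +oo[.
  apply/funext => x; rewrite patchE mem_setE in_itv/= andbT.
  by case: (leP x 0) => [|/ltW]; case: ltrgtP => //; rewrite ?mul0r// => ->; rewrite mul0r.
rewrite -integral_mkcond (@ge0_continuous_FTC2y _ _ (fun x => - phi x) 0 0).
- by rewrite std_normal_pdf0 sub0e EFinN oppeK.
- by move=> x x0; rewrite mulr_ge0// std_normal_pdf_ge0.
- apply: continuous_subspaceT => x; apply: cvgM; first exact: cvg_id.
  exact: continuous_std_normal_pdf.
- rewrite -[X in _ --> X]oppr0; apply: cvgN.
  apply: (@squeeze_cvgr _ _ _ _ (cst 0) (fun x => 2 * x^-1)).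
  + near=> x; rewrite std_normal_pdf_ge0/= (le_trans (std_normal_pdf_le_expR x))//.
    have x1 : 1 <= x by near: x; exact: nbhs_pinfty_ge.
    have x0 : 0 < x by exact: lt_le_trans x1.
    rewrite mulNr expRN -div1r ler_pdivrMr ?expR_gt0// mulrAC ler_pdivlMr// mul1r.
    have := @expR_ge1Dx R (x ^+ 2 / 2); nra.
  + exact: cvg_cst.
  + rewrite -[X in _ --> X](mulr0 2); apply: cvgMr.
    apply/gtr0_cvgV0; last exact: cvg_id.
    exact: nbhs_pinfty_gt.
- by move=> x _; have [] := is_derive_std_normal_pdf x => d _; apply: derivableN.
- apply: cvg_at_right_filter; apply: cvgN; exact: continuous_std_normal_pdf.
- move=> x _; rewrite derive1E; have [d e] := is_derive_std_normal_pdf x.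
  by rewrite deriveN// e opprK.
Unshelve. all: end_near. Qed.

(** As a function D of a, the integral has derivative - a D: differentiate under the integral
sign and apply the Stein identity to sin (a x + b). Hence D(a) exp (a^2 / 2) is constant. *)
Lemma integral_cos_std_normal (a b : R) :
  \int[gam]_x cos (a * x + b) = expR (- a ^+ 2 / 2) * cos b.
Proof.
pose f (a x : R) := cos (a * x + b) * phi x.
pose D a := \int[leb]_x f a x.
have mcos c : measurable_fun [set: R] (fun x : R => cos (c * x + b)).
  apply: continuous_measurable_fun => x.
  apply: (@cvg_comp _ _ _ (fun x => c * x + b) cos); last exact: continuous_cos.
  by apply: cvgD; [apply: cvgM; [exact: cvg_cst|exact: cvg_id]|exact: cvg_cst].
have msin c : measurable_fun [set: R] (fun x : R => sin (c * x + b)).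
  apply: continuous_measurable_fun => x.
  apply: (@cvg_comp _ _ _ (fun x => c * x + b) sin); last exact: continuous_sin.
  by apply: cvgD; [apply: cvgM; [exact: cvg_cst|exact: cvg_id]|exact: cvg_cst].
suff -> : \int[gam]_x cos (a * x + b) = expR (- a ^+ 2 / 2) * D 0.
  congr (_ * _); rewrite /D /f.
  under eq_Rintegral do rewrite mul0r add0r.
  rewrite RintegralZl//; last exact: integrable_normal_pdf.
  by rewrite /Rintegral (integral_normal_pdf 0 1) mulr1.
rewrite Rintegral_std_normal// -/(D a).
have df (c x : R) : is_derive c 1 (f^~ x) (- (x * sin (c * x + b)) * phi x).
  apply: is_derive_eq; rewrite /GRing.scale/=; ring.
have intf c : leb.-integrable [set: R] (EFin \o f c).
  apply: (integrable_std_normal_sqr (f := fun x => cos (c * x + b)) (C := 1) _ _).1 => //.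
  by move=> x; rewrite mul1r (le_trans (cos_max _))// lerDl sqr_ge0.
have intG : leb.-integrable [set: R] (EFin \o (fun x => `|x| * phi x)).
  apply: (integrable_std_normal_sqr (f := fun x => `|x|) (C := 1) _ _).1 => //.
  move=> x; rewrite normr_id mul1r -(real_normK (num_real x)).
  by have := normr_ge0 x; nra.
have dD (c : R) : is_derive c 1 D (- (c * D c)).
  have cI : `]c - 1, c + 1[%classic c by rewrite /= in_itv/=; apply/andP; split; lra.
  have der x y : `]c - 1, c + 1[%classic x -> [set: R] y -> derivable (f^~ y) x 1.
    by move=> _ _; have [] := df x y.
  have ub x y : `]c - 1, c + 1[%classic x -> [set: R] y -> `|partial1of2 f x y| <= `|y| * phi y.
    move=> _ _; rewrite partial1of2E; have [_ ->] := df x y.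
    rewrite normrM (ger0_norm (std_normal_pdf_ge0 _)) ler_wpM2r ?std_normal_pdf_ge0//.
    by rewrite normrN normrM ler_piMr// sin_max.
  have G0 y : 0 <= `|y| * phi y by rewrite mulr_ge0// std_normal_pdf_ge0.
  apply: DeriveDef.
    exact: (@derivable_under_integral _ _ (measurableTypeR R) leb f setT measurableT
       c (c - 1) (c + 1) cI (fun x _ => intf x) der _ G0 intG ub).
  rewrite -derive1E (@differentiation_under_integral _ _ (measurableTypeR R) leb f setT measurableT
       c (c - 1) (c + 1) cI (fun x _ => intf x) der _ G0 intG ub).
  under eq_Rintegral => x _ do (rewrite partial1of2E; have [_ ->] := df c x).
  rewrite (@eq_Rintegral _ _ _ leb setT (fun x => - 1 * (x * sin (c * x + b) * phi x))); last first.
    by move=> x _; rewrite mulN1r mulNr.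
  rewrite RintegralZl//; last first.
    apply: (integrable_std_normal_sqr (f := fun x => x * sin (c * x + b)) (C := 1) _ _).1.
      by apply: measurable_funM => //; exact: msin.
    move=> x; rewrite mul1r normrM -(real_normK (num_real x)).
    by have := sin_max (c * x + b); have := normr_ge0 x; nra.
  rewrite mulN1r; congr (- _).
  have ds (x : R) : is_derive x 1 (fun x => sin (c * x + b)) (c * cos (c * x + b)).
    by apply: is_derive_eq; rewrite /GRing.scale/=; ring.
  rewrite -(@std_normal_by_parts R _ _ (1 + `|c|) ds).
  - rewrite /D -(RintegralZl c measurableT (intf c)).
    by apply: eq_Rintegral => x _; rewrite /f mulrA.
  - move=> x; apply: cvgM; first exact: cvg_cst.
    apply: (@cvg_comp _ _ _ (fun x => c * x + b) cos); last exact: continuous_cos.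
    by apply: cvgD; [apply: cvgM; [exact: cvg_cst|exact: cvg_id]|exact: cvg_cst].
  - move=> x; rewrite (le_trans (sin_max _))//.
    by have := normr_ge0 x; have := normr_ge0 c; nra.
  - move=> x; rewrite normrM.
    by have := cos_max (c * x + b); have := normr_ge0 x; have := normr_ge0 c; nra.
pose E c := D c * expR (c ^+ 2 / 2).
have dE (c : R) : is_derive c 1 E 0.
  have d1 := dD c.
  by apply: is_derive_eq; rewrite /GRing.scale/=; field.
have := is_derive_0_is_cst a 0 dE; rewrite /E expr0n mul0r expR0 mulr1 => <-.
by rewrite mulrCA -expRD -mulrDl addNr mul0r expR0 mulr1.
Qed.

Lemma normal_prob_tail x : gam `]x, +oo[ = (std_normal_tail x)%:E.
Proof.
rewrite /std_normal_tail /Rintegral normal_probE integral_itv_obnd_cbnd.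
  rewrite fineK// -normal_probE; exact: fin_num_measure.
by apply/measurable_funTS/measurable_EFinP; exact: measurable_std_normal_pdf.
Qed.

Lemma normal_prob_tail_cy x : gam `[x, +oo[ = (std_normal_tail x)%:E.
Proof. by rewrite /std_normal_tail /Rintegral -normal_probE fineK ?fin_num_measure. Qed.

Lemma std_normal_tail_ge0 x : 0 <= std_normal_tail x :> R.
Proof. by rewrite -lee_fin -normal_prob_tail. Qed.

Lemma std_normal_tail_le1 x : std_normal_tail x <= 1 :> R.
Proof. by rewrite -lee_fin -normal_prob_tail; exact: probability_le1. Qed.

Lemma std_normal_pdf_nonincreasing (u x : R) : 0 <= u -> u <= x -> phi x <= phi u.
Proof.
move=> u0 ux; rewrite !std_normal_pdfE ler_wpM2l ?invr_ge0//.
rewrite ler_expR ler_pM2r ?invr_gt0// lerN2 ler_sqr ?nnegrE//.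
exact: le_trans ux.
Qed.

Lemma normal_prob_itv_le (a b K : R) : a <= b ->
  (forall x, a <= x -> phi x <= K) -> (gam `]a, b] <= (K * (b - a))%:E)%E.
Proof.
move=> ab phiK; rewrite normal_probE.
apply: (@le_trans _ _ (\int[leb]_(x in `]a, b]) (cst K%:E x))%E).
  apply: ge0_le_integral => //.
  - by move=> x _; rewrite lee_fin std_normal_pdf_ge0.
  - by apply/measurable_funTS/measurable_EFinP; exact: measurable_std_normal_pdf.
  - by move=> x /=; rewrite in_itv/= => /andP[ax _]; rewrite lee_fin phiK// ltW.
rewrite integral_cst//= lebesgue_measure_itv/= lte_fin.
case: ltgtP ab => // -> _; by rewrite subrr mulr0 mule0.
Qed.

(** The density is at most 1. *)
Lemma std_normal_tailB_le (x z : R) : 0 <= z ->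
  std_normal_tail (x - z) <= std_normal_tail x + z.
Proof.
move=> z0; rewrite -lee_fin EFinD -!normal_prob_tail.
have -> : `]x - z, +oo[%classic = `]x, +oo[%classic `|` `]x - z, x]%classic.
  apply/seteqP; split=> y /=; rewrite !in_itv/= !andbT.
    by move=> h; case: (ltP x y) => xy; [left|right; rewrite h].
  by move=> [xy|/andP[]//]; rewrite (le_lt_trans _ xy)// gerBl.
rewrite (le_trans (measureU2 _ _ _))// leeD2l//.
rewrite (le_trans (@normal_prob_itv_le (x - z) x 1 _ _))//.
- by rewrite gerBl.
- by move=> y _; exact: std_normal_pdf_le1.
- by rewrite mul1r subKr.
Qed.

Lemma std_normal_tail_nonincreasing (x y : R) : x <= y -> std_normal_tail y <= std_normal_tail x.
Proof.
move=> xy; rewrite -lee_fin -!normal_prob_tail le_measure ?inE//.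
by move=> z /=; rewrite !in_itv/= !andbT; exact: le_lt_trans.
Qed.

End std_normal_integrals.

(** * Trigonometric polynomials determine a normal law *)

Lemma measurable_cos (R : realType) : measurable_fun [set: R] (@cos R).
Proof. by apply: continuous_measurable_fun; exact: continuous_cos. Qed.

Section trigonometric_polynomials.
Context {R : realType}.

(** Only the phase-shifted cosines are listed: sines and constants are instances. *)
Inductive trigpoly : (R -> R) -> Prop :=
| TrigCos (c a b : R) : trigpoly (fun x => c * cos (a * x + b))
| TrigAdd (f g : R -> R) :
    trigpoly f -> trigpoly g -> trigpoly (fun x => f x + g x).

Lemma trigpoly_cst (c : R) : trigpoly (fun=> c).
Proof.
have -> : (fun=> c) = (fun x : R => c * cos (0 * x + 0)).
  by apply/funext => x; rewrite mul0r add0r cos0 mulr1.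
exact: TrigCos.
Qed.

Lemma trigpoly_mul (f g : R -> R) :
  trigpoly f -> trigpoly g -> trigpoly (fun x => f x * g x).
Proof.
move=> tf tg; elim: tf => {f} [c a b|f1 f2 _ h1 _ h2]; last first.
  under eq_fun do rewrite mulrDl.
  exact: TrigAdd.
elim: tg => {g} [c' a' b'|f1 f2 _ h1 _ h2]; last first.
  under eq_fun do rewrite mulrDr.
  exact: TrigAdd.
have -> : (fun x => c * cos (a * x + b) * (c' * cos (a' * x + b'))) =
  (fun x => (c * c' / 2) * cos ((a + a') * x + (b + b')) +
            (c * c' / 2) * cos ((a - a') * x + (b - b'))).
  apply/funext => x.
  have -> : (a + a') * x + (b + b') = (a * x + b) + (a' * x + b') by ring.
  have -> : (a - a') * x + (b - b') = (a * x + b) - (a' * x + b') by ring.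
  by move: (_ * x + b) (_ * x + b') => A B; rewrite cosD cosB; field.
by apply: TrigAdd; exact: TrigCos.
Qed.

(** An odd polynomial map of [-1, 1] to itself with repelling fixed point 0 and attracting
fixed points -1 and 1. Its iterates converge to the sign function, and being polynomial
they send trigonometric polynomials to trigonometric polynomials. *)
Definition smoothstep (y : R) : R := y * (3 - y ^+ 2) / 2.

Lemma trigpoly_iter_smoothstep n (f : R -> R) :
  trigpoly f -> trigpoly (fun x => iter n smoothstep (f x)).
Proof.
move=> tf; elim: n => [//|n ih] /=.
set g := (fun x => iter n smoothstep (f x)) in ih *.
have -> : (fun x => smoothstep (iter n smoothstep (f x))) =
  (fun x => g x * (3 / 2) + (- 1 / 2) * (g x * (g x * g x))).
  by apply/funext => x; rewrite /smoothstep -/(g x); field.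
by apply: TrigAdd; repeat (apply: trigpoly_mul || exact: trigpoly_cst || exact: ih).
Qed.

Lemma iter_smoothstep0 n : iter n smoothstep 0 = 0.
Proof. by elim: n => //= n ->; rewrite /smoothstep !mul0r. Qed.

Lemma iter_smoothstepN n (y : R) : iter n smoothstep (- y) = - iter n smoothstep y.
Proof. by elim: n => //= n ->; rewrite /smoothstep; ring. Qed.

Lemma iter_smoothstep_pos n (y : R) : 0 < y <= 1 ->
  y <= iter n smoothstep y <= 1 /\ 1 - iter n smoothstep y <= (1 - y / 2) ^+ n.
Proof.
move=> /andP[y0 y1]; elim: n => [|n]; first by rewrite /= expr0 lexx y1; split=> //; lra.
rewrite [iter n.+1 _ _]/=; set z := iter n smoothstep y => -[/andP[yz z1] h].
(* The distance to 1 shrinks by the factor (1 - z) (2 + z) / 2 = 1 - z (1 + z) / 2. *)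
have e : 1 - smoothstep z = (1 - z) * ((1 - z) * (2 + z) / 2).
  by rewrite /smoothstep; field.
have e2 : smoothstep z - z = z * (1 - z) * (1 + z) / 2.
  by rewrite /smoothstep; field.
have z0 : 0 < z by exact: lt_le_trans yz.
have b1 : 0 <= (1 - z) * (2 + z) / 2 by rewrite divr_ge0// mulr_ge0//; lra.
have b2 : (1 - z) * (2 + z) / 2 <= 1 - y / 2 by nra.
have b3 : 0 <= 1 - smoothstep z by rewrite e mulr_ge0// subr_ge0.
have b4 : 0 <= smoothstep z - z.
  by rewrite e2 divr_ge0// mulr_ge0//; [rewrite mulr_ge0//; lra|lra].
split; first by apply/andP; split; lra.
rewrite e exprS mulrC; apply: ler_pM => //; lra.
Qed.

Lemma cvg_iter_smoothstep (y : R) : -1 <= y <= 1 ->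
  iter n smoothstep y @[n --> \oo] --> Num.sg y.
Proof.
move=> y11.
have pos (z : R) : 0 < z <= 1 -> iter n smoothstep z @[n --> \oo] --> (1 : R).
  move=> z01; have /andP[z0 z1] := z01.
  apply: (@squeeze_cvgr _ _ _ _ (fun n => 1 - (1 - z / 2) ^+ n) (cst 1)).
  - apply: nearW => n; have [/andP[_ h1] h2] := iter_smoothstep_pos n z01.
    by rewrite h1 andbT; lra.
  - rewrite -[X in _ --> X]subr0; apply: cvgB; first exact: cvg_cst.
    by apply: cvg_expr; rewrite ger0_norm; lra.
  - exact: cvg_cst.
have [y0|y0|->] := ltgtP y 0.
- rewrite ltr0_sg// -(opprK y); under eq_fun do rewrite iter_smoothstepN.
  by apply: cvgN; apply: pos; lra.
- by rewrite gtr0_sg//; apply: pos; lra.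
- by rewrite sgr0; under eq_fun do rewrite iter_smoothstep0; exact: cvg_cst.
Qed.

Lemma norm_iter_smoothstep n (y : R) : -1 <= y <= 1 -> `|iter n smoothstep y| <= 1.
Proof.
move=> y11.
have pos (z : R) : 0 < z <= 1 -> `|iter n smoothstep z| <= 1.
  move=> z01; have [/andP[h h1] _] := iter_smoothstep_pos n z01.
  by rewrite ger0_norm//; lra.
have [y0|y0|->] := ltgtP y 0.
- by rewrite -(opprK y) iter_smoothstepN normrN; apply: pos; lra.
- by apply: pos; lra.
- by rewrite iter_smoothstep0 normr0.
Qed.

End trigonometric_polynomials.

Section weighted_law.
Context d {Omega : measurableType d} {R : realType} (P : probability Omega R).
Local Notation gam := (@normal_prob R 0 1).

Lemma bounded_integrable (f : Omega -> R) (M : R) : measurable_fun [set: Omega] f ->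
  (forall w, `|f w| <= M) -> P.-integrable [set: Omega] (EFin \o f).
Proof.
move=> mf fM; apply: (integrable_dominated mf fM).
exact: finite_measure_integrable_cst.
Qed.

Variables (g U : Omega -> R) (M kappa : R).
Hypotheses (mg : measurable_fun [set: Omega] g) (gM : forall w, `|g w| <= M).
Hypothesis mU : measurable_fun [set: Omega] U.
Hypothesis gU : forall a b, \int[P]_w (g w * cos (a * U w + b)) =
  kappa * (expR (- a ^+ 2 / 2) * cos b).

(** The functions for which the weighted law of U acts as kappa times the normal law; the
boundedness makes this class stable under bounded pointwise limits. *)
Let Q (f : R -> R) :=
  [/\ measurable_fun [set: R] f, exists C : R, forall x, `|f x| <= C &
      \int[P]_w (g w * f (U w)) = kappa * \int[gam]_x f x].

Let integrable_gf (f : R -> R) (C : R) : measurable_fun [set: R] f -> (forall x, `|f x| <= C) ->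
  P.-integrable [set: Omega] (EFin \o (fun w => g w * f (U w))).
Proof.
move=> mf fC; apply: (@bounded_integrable _ (M * C)).
  by apply: measurable_funM => //; exact: measurableT_comp.
by move=> w; rewrite normrM ler_pM.
Qed.

Let integrable_f (f : R -> R) (C : R) : measurable_fun [set: R] f -> (forall x, `|f x| <= C) ->
  gam.-integrable [set: R] (EFin \o f).
Proof.
move=> mf fC; apply: (@integrable_dominated _ (measurableTypeR R) R gam f (cst C)) => //.
exact: finite_measure_integrable_cst.
Qed.

Let QD (f1 f2 : R -> R) : Q f1 -> Q f2 -> Q (fun x => f1 x + f2 x).
Proof.
move=> [m1 [C1 b1] e1] [m2 [C2 b2] e2]; split.
- exact: measurable_funD.
- by exists (C1 + C2) => x; rewrite (le_trans (ler_normD _ _))// lerD.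
- rewrite RintegralD//; [|exact: integrable_f b1|exact: integrable_f b2].
  rewrite mulrDr -e1 -e2 -RintegralD//.
  + by apply: eq_Rintegral => w _; rewrite mulrDr.
  + exact: integrable_gf b1.
  + exact: integrable_gf b2.
Qed.

Let QZ (c : R) (f1 : R -> R) : Q f1 -> Q (fun x => c * f1 x).
Proof.
move=> [m1 [C1 b1] e1]; split.
- exact: measurable_funM.
- by exists (`|c| * C1) => x; rewrite normrM ler_wpM2l.
- rewrite RintegralZl//; last exact: integrable_f b1.
  rewrite mulrCA -e1 -RintegralZl//.
  + by apply: eq_Rintegral => w _; rewrite mulrCA.
  + exact: integrable_gf b1.
Qed.

Let Qlim (f_ : nat -> R -> R) (f : R -> R) (C : R) : (forall n, Q (f_ n)) ->
  (forall n x, `|f_ n x| <= C) -> (forall x, f_ n x @[n --> \oo] --> f x) -> Q f.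
Proof.
move=> Qf_ f_C f_f.
have mf : measurable_fun [set: R] f.
  apply: (@measurable_fun_cvg _ _ _ _ f_) => [n|x _]; last exact: f_f.
  by have [] := Qf_ n.
split => //.
  exists C => x; have h := f_f x.
  have cn : `|f_ n x| @[n --> \oo] --> `|f x| by apply: cvg_norm.
  rewrite -(cvg_lim _ cn)//; apply: limr_le; first by apply/cvg_ex; eexists; exact: cn.
  exact: nearW.
have c1 : (\int[P]_w (g w * f_ n (U w))) @[n --> \oo] --> \int[P]_w (g w * f (U w)).
  apply: (@cvg_Rintegral_dominated _ _ _ P _ _ (cst (M * C))).
  - move=> n; apply: measurable_funM => //; apply: measurableT_comp => //.
    by have [] := Qf_ n.
  - by move=> w; apply: cvgM; [exact: cvg_cst|exact: f_f].
  - by move=> n w; rewrite normrM ler_pM.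
  - exact: finite_measure_integrable_cst.
have c2 : (\int[gam]_x f_ n x) @[n --> \oo] --> \int[gam]_x f x.
  apply: (@cvg_Rintegral_dominated _ (measurableTypeR R) _ gam _ _ (cst C)) => //.
  - by move=> n; have [] := Qf_ n.
  - exact: finite_measure_integrable_cst.
have {c2} : (\int[P]_w (g w * f_ n (U w))) @[n --> \oo] --> kappa * \int[gam]_x f x.
  under eq_fun => n do (have [_ _ ->] := Qf_ n).
  by apply: cvgM => //; exact: cvg_cst.
by move/(cvg_unique _ c1); exact.
Qed.

Let Qtrig (f1 : R -> R) : trigpoly f1 -> Q f1.
Proof.
elim => {f1} [c a b|f1 f2 _ q1 _ q2]; last exact: QD.
apply: QZ; split.
- apply: (measurableT_comp (@measurable_cos R)).
  by apply: measurable_funD => //; exact: measurable_funM.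
- by exists 1 => x; exact: cos_max.
- by rewrite gU integral_cos_std_normal.
Qed.

Let Q_cst (c : R) : Q (fun=> c).
Proof. by apply: Qtrig; exact: trigpoly_cst. Qed.

(** The sign of sin ((x - c) / n) equals the sign of x - c once n exceeds |x - c|, and is the
limit of the iterates of [smoothstep] at that sine. The polynomial (y + y^2) / 2 takes
the values 0, 0, 1 at -1, 0, 1, so it turns the sign into the indicator of the ray. *)
Let Qray (c : R) : Q (\1_(`]c, +oo[%classic : set R)).
Proof.
pose S (L : nat) (x : R) := sin ((x - c) / L.+1%:R).
have tS L : trigpoly (S L).
  have -> : S L = (fun x => 1 * cos (L.+1%:R^-1 * x + (- c / L.+1%:R - pi / 2))).
    apply/funext => x; rewrite mul1r addrA cosBpihalf /S; congr sin.
    by rewrite mulrC mulrBr mulNr [c / _]mulrC.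
  exact: TrigCos.
have S1 L x : -1 <= S L x <= 1 by rewrite sin_geN1 sin_le1.
pose pos (y : R) := (y + y ^+ 2) / 2.
have posb (y : R) : `|y| <= 1 -> `|pos y| <= 1.
  by rewrite /pos !ler_norml => /andP[h1 h2]; apply/andP; split; nra.
have QS L : Q (fun x => pos (Num.sg (S L x))).
  apply: (@Qlim (fun n x => pos (iter n smoothstep (S L x))) _ 1).
  - move=> n; apply: Qtrig.
    have ti := trigpoly_iter_smoothstep n (tS L).
    have -> : (fun x => pos (iter n smoothstep (S L x))) = (fun x =>
        2^-1 * iter n smoothstep (S L x) +
        2^-1 * (iter n smoothstep (S L x) * iter n smoothstep (S L x))).
      by apply/funext => x; rewrite /pos; field.
    by apply: TrigAdd; repeat (apply: trigpoly_mul || exact: trigpoly_cst || exact: ti).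
  - by move=> n x; apply: posb; exact: norm_iter_smoothstep.
  - move=> x; have cs := cvg_iter_smoothstep (S1 L x).
    rewrite /pos; apply: cvgM; last exact: cvg_cst.
    by apply: cvgD => //; apply: cvgM.
apply: (@Qlim (fun L x => pos (Num.sg (S L x))) _ 1) => //.
  move=> n x; apply: posb; rewrite normr_sg; by case: (_ == _).
move=> x; apply: cvg_near_cst; near=> L.
have L0 : (0 : R) < L.+1%:R by rewrite ltr0n.
have dL : `|x - c| <= L.+1%:R.
  rewrite (@le_trans _ _ L%:R)// ?ler_nat//.
  by near: L; exact: nbhs_infty_ger.
have pi1 : 1 < pi :> R by have := @pi_ge2 R; lra.
rewrite indicE mem_setE in_itv/= andbT /S /pos; apply/eqP.
have [xc|xc|->] := ltgtP x c.
- rewrite ltr0_sg; first by rewrite sqrrN expr1n addNr mul0r.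
  rewrite -oppr_gt0 -sinN sin_gt0_pi// -mulNr opprB divr_gt0//= ?subr_gt0//.
  rewrite (le_lt_trans _ pi1)// ler_pdivrMr// mul1r (le_trans _ dL)//.
  by rewrite distrC ler_norm.
- rewrite gtr0_sg; first by rewrite expr1n divff.
  rewrite sin_gt0_pi// divr_gt0//= ?subr_gt0//.
  by rewrite (le_lt_trans _ pi1)// ler_pdivrMr// mul1r (le_trans _ dL)// ler_norm.
- by rewrite subrr mul0r sin0 sgr0 expr0n addr0 mul0r.
Unshelve. all: end_near. Qed.

(** Uniqueness theorem for characteristic functions, for a signed weight and a normal
target. With g = 1 it identifies the law of U; with g an indicator or a cosine of other
variables it also gives independence from them. *)
Lemma normal_weighted_law (B : set R) : measurable B ->
  \int[P]_w (g w * \1_B (U w)) = kappa * fine (gam B).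
Proof.
move=> mB0.
suff [_ _ ->] : Q \1_B by rewrite /Rintegral integral_indic ?setIT.
move: B mB0; apply: borel_induction.
- by rewrite indicT; exact: Q_cst.
- exact: Qray.
- move=> B mB QB; rewrite (_ : \1_(~` B) = (fun x => 1 + -1 * \1_B x)); last first.
    by apply/funext => x; rewrite indicC indicE; case: (x \in B) => /=; ring.
  by apply: QD => //; exact: QZ.
- move=> F mF tF QF.
  have QU n : Q \1_(\big[setU/set0]_(i < n) F i).
    elim: n => [|n ih]; first by rewrite big_ord0 indic0; exact: Q_cst.
    rewrite big_ord_recr/= (_ : \1_(_ `|` _) =
      (fun x => \1_(\big[setU/set0]_(i < n) F i) x + \1_(F n) x)); first exact: QD.
    apply/funext => x; rewrite !indicE in_setU.
    have [xF|xF] := boolP (x \in F n); last by rewrite orbF addr0.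
    rewrite orbT memNset ?add0r// -bigcup_mkord => -[k /= kn Fkx].
    have kn' : k = n by apply: (tF k n I I); exists x; split => //; exact: set_mem.
    by rewrite kn' ltnn in kn.
  apply: (Qlim QU (C := 1)).
  + by move=> n x; rewrite indicE; case: (_ \in _); rewrite ?normr1 ?normr0.
  + move=> x; apply: cvg_near_cst.
    have [[k _ Fkx]|nF] := pselect ((\bigcup_k F k) x).
      near=> n; rewrite !indicE !mem_set//; first by exists k.
      by rewrite -bigcup_mkord; exists k => //=; near: n; exact: nbhs_infty_gt.
    apply: nearW => n; rewrite !indicE !memNset// -bigcup_mkord => -[k _ Fkx].
    by apply: nF; exists k.
Unshelve. all: end_near. Qed.

End weighted_law.

(** * Independent standard normal variables from characteristic functions *)

Section iid_normal.
Context d {Omega : measurableType d} {R : realType} (P : probability Omega R).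
Local Notation gam := (@normal_prob R 0 1).
Local Notation mR := (measurableTypeR R).

(** Replaces, in a joint characteristic function, the variable U by an event on U. Applied once
for each variable, it turns the characteristic function of an independent normal family
into the probability of a rectangle. The shift th makes cosines suffice where
exponentials would be used: the identity for all th carries the sine part as well. *)
Lemma peel_normal_factor (h Z U : Omega -> R) (M k : R) :
  measurable_fun [set: Omega] h -> (forall w, `|h w| <= M) ->
  measurable_fun [set: Omega] Z -> measurable_fun [set: Omega] U ->
  (forall b th, \int[P]_w (h w * cos (b * U w + Z w + th)) =
     k * (expR (- b ^+ 2 / 2) * cos th)) ->
  forall (B : set R) th, measurable B ->
    \int[P]_w (h w * \1_B (U w) * cos (Z w + th)) = k * fine (gam B) * cos th.
Proof.
move=> mh hM mZ mU hyp B th mB.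
have mc (b t : R) : measurable_fun [set: Omega] (fun w => cos (b * U w + Z w + t)).
  apply: (measurableT_comp (@measurable_cos R)).
  by do 2! apply: measurable_funD => //; exact: measurable_funM.
have ih (b t : R) : P.-integrable [set: Omega]
    (EFin \o (fun w => h w * cos (b * U w + Z w + t))).
  apply: (@bounded_integrable _ _ _ _ _ M).
    exact: measurable_funM.
  by move=> w; rewrite normrM -[leRHS]mulr1 ler_pM// cos_max.
have mg : measurable_fun [set: Omega] (fun w => h w * cos (Z w + th)).
  apply: measurable_funM => //; apply: (measurableT_comp (@measurable_cos R)).
  exact: measurable_funD.
have gM w : `|h w * cos (Z w + th)| <= M.
  by rewrite normrM -[leRHS]mulr1 ler_pM// cos_max.
have := @normal_weighted_law _ _ _ P (fun w => h w * cos (Z w + th)) U M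
  (k * cos th) mg gM mU _ B mB.
under eq_Rintegral do rewrite mulrAC.
rewrite [k * _ * _]mulrAC => -> // a b.
(* cos x cos y is half of cos (x + y) + cos (x - y). *)
rewrite (@eq_Rintegral _ _ _ _ _ (fun w => 2^-1 * (h w * cos (a * U w + Z w + (th + b)) +
   h w * cos (- a * U w + Z w + (th - b))))); last first.
  move=> w _.
  have -> : a * U w + Z w + (th + b) = (Z w + th) + (a * U w + b) by ring.
  have -> : - a * U w + Z w + (th - b) = (Z w + th) - (a * U w + b) by ring.
  by move: (Z w + th) (a * U w + b) => x y; rewrite cosD cosB; field.
rewrite RintegralZl//; last first.
  rewrite (_ : EFin \o _ = (fun w => (h w * cos (a * U w + Z w + (th + b)))%:E +
    (h w * cos (- a * U w + Z w + (th - b)))%:E)%E)//.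
  exact: integrableD (ih _ _) (ih _ _).
by rewrite RintegralD// !hyp sqrrN cosD cosB; field.
Qed.

Lemma iid_normal2 (V Z : Omega -> R) :
  measurable_fun [set: Omega] V -> measurable_fun [set: Omega] Z ->
  (forall b c th, \int[P]_w cos (b * V w + c * Z w + th) =
    expR (- (b ^+ 2 + c ^+ 2) / 2) * cos th) ->
  forall S : set (mR * mR), measurable S ->
  P [set w | S (V w, Z w)] = (gam \x gam)%E S.
Proof.
move=> mV mZ hyp S mS.
have mI (D : set R) : measurable D -> measurable_fun [set: Omega] (fun w => \1_D (V w) : R).
  by move=> mD; apply: measurableT_comp => //; exact: measurable_indic.
have I1 (D : set R) w : `|\1_D (V w) : R| <= 1.
  by rewrite indicE; case: (_ \in _); rewrite ?normr1 ?normr0.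
have s1 (B : set R) c th : measurable B -> \int[P]_w (\1_B (V w) * cos (c * Z w + th)) =
    expR (- c ^+ 2 / 2) * fine (gam B) * cos th.
  move=> mB; under eq_Rintegral do rewrite -[X in X * _]mul1r.
  apply: (@peel_normal_factor (cst 1) (fun w => c * Z w) V 1) => //.
  - by move=> w; rewrite normr1.
  - exact: measurable_funM.
  - move=> b t; under eq_Rintegral do rewrite mul1r.
    by rewrite hyp mulrA -expRD; congr (expR _ * _); field.
have mVZ : measurable_fun [set: Omega] ((fun w => (V w, Z w)) : Omega -> (mR * mR)%type).
  exact: measurable_fun_pair.
pose VZ : {mfun Omega >-> (mR * mR)%type} :=
  HB.pack (fun w => (V w, Z w)) (isMeasurableFun.Build _ _ _ _ _ mVZ).
apply/esym; apply: (@product_measure_unique _ _ mR mR R gam gam (distribution P VZ)) => //.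
move=> B C mB mC.
have : \int[P]_w (\1_B (V w) * \1_C (Z w) * cos (0 + 0)) =
    fine (gam B) * fine (gam C) * cos 0.
  apply: (@peel_normal_factor (fun w => \1_B (V w)) (cst 0) Z 1) => //; first exact: mI.
  move=> c t; under eq_Rintegral do rewrite addr0.
  by rewrite s1//; ring.
rewrite addr0 cos0 mulr1; under eq_Rintegral do rewrite mulr1.
have mE : measurable (V @^-1` B `&` Z @^-1` C).
  by apply: measurableI; rewrite -[X in measurable X]setTI; [exact: mV|exact: mZ].
rewrite (@eq_Rintegral _ _ _ _ _ (\1_(V @^-1` B `&` Z @^-1` C))); last first.
  move=> w _; rewrite !indicE in_setI.
  rewrite -[w \in V @^-1` B]/(V w \in B) -[w \in Z @^-1` C]/(Z w \in C).
  by case: (_ \in B); case: (_ \in C); rewrite /= ?mulr0 ?mul0r ?mulr1.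
rewrite /Rintegral integral_indic// setIT => e.
rewrite -[LHS]/(P (V @^-1` B `&` Z @^-1` C)).
rewrite -[LHS]fineK ?fin_num_measure// e !EFinM.
by rewrite !fineK ?fin_num_measure.
Qed.

Lemma iid_normal3_rect (W V Z : Omega -> R) :
  measurable_fun [set: Omega] W -> measurable_fun [set: Omega] V ->
  measurable_fun [set: Omega] Z ->
  (forall a b c th, \int[P]_w cos (a * W w + b * V w + c * Z w + th) =
    expR (- (a ^+ 2 + b ^+ 2 + c ^+ 2) / 2) * cos th) ->
  forall A B C : set R, measurable A -> measurable B -> measurable C ->
  P (W @^-1` A `&` (V @^-1` B `&` Z @^-1` C)) = (gam A * (gam B * gam C))%E.
Proof.
move=> mW mV mZ hyp A B C mA mB mC.
have mI (X : Omega -> R) (D : set R) : measurable_fun [set: Omega] X ->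
    measurable D -> measurable_fun [set: Omega] (fun w => \1_D (X w) : R).
  by move=> mX mD; apply: measurableT_comp => //; exact: measurable_indic.
have I1 (X : Omega -> R) (D : set R) w : `|\1_D (X w) : R| <= 1.
  by rewrite indicE; case: (_ \in _); rewrite ?normr1 ?normr0.
have s1 b c th : \int[P]_w (\1_A (W w) * cos (b * V w + c * Z w + th)) =
    expR (- (b ^+ 2 + c ^+ 2) / 2) * fine (gam A) * cos th.
  under eq_Rintegral do rewrite -[X in X * _]mul1r.
  apply: (@peel_normal_factor (cst 1) (fun w => b * V w + c * Z w) W 1) => //.
  - by move=> w; rewrite normr1.
  - by apply: measurable_funD; exact: measurable_funM.
  - move=> a t; under eq_Rintegral do rewrite mul1r addrA.
    by rewrite hyp mulrA -expRD; congr (expR _ * _); field.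
have s2 c th : \int[P]_w (\1_A (W w) * \1_B (V w) * cos (c * Z w + th)) =
    expR (- c ^+ 2 / 2) * fine (gam A) * fine (gam B) * cos th.
  apply: (@peel_normal_factor (fun w => \1_A (W w)) (fun w => c * Z w) V 1) => //.
  - exact: mI.
  - exact: measurable_funM.
  - move=> b t; rewrite s1 [RHS]mulrA; congr (_ * _).
    by rewrite [RHS]mulrAC -expRD; congr (expR _ * _); field.
have s3 : \int[P]_w (\1_A (W w) * \1_B (V w) * \1_C (Z w) * cos (0 + 0)) =
    fine (gam A) * fine (gam B) * fine (gam C) * cos 0.
  apply: (@peel_normal_factor (fun w => \1_A (W w) * \1_B (V w)) (cst 0) Z 1) => //.
  - by apply: measurable_funM; exact: mI.
  - by move=> w; rewrite normrM -[leRHS]mulr1 ler_pM.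
  - move=> c t; under eq_Rintegral do rewrite addr0.
    by rewrite s2; ring.
move: s3; rewrite addr0 cos0 mulr1; under eq_Rintegral do rewrite mulr1.
have mE : measurable (W @^-1` A `&` (V @^-1` B `&` Z @^-1` C)).
  have h (X : Omega -> R) (D : set R) : measurable_fun [set: Omega] X ->
    measurable D -> measurable (X @^-1` D).
    by move=> mX mD; rewrite -[X in measurable X]setTI; exact: mX.
  by apply: measurableI; [exact: h|apply: measurableI; exact: h].
rewrite (@eq_Rintegral _ _ _ _ _ (\1_(W @^-1` A `&` (V @^-1` B `&` Z @^-1` C)))); last first.
  move=> w _; rewrite !indicE !in_setI.
  rewrite -[w \in W @^-1` A]/(W w \in A) -[w \in V @^-1` B]/(V w \in B)
    -[w \in Z @^-1` C]/(Z w \in C).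
  by case: (_ \in A); case: (_ \in B); case: (_ \in C); rewrite /= ?mulr0 ?mul0r ?mulr1.
rewrite /Rintegral integral_indic// setIT => e.
rewrite -[LHS]fineK ?fin_num_measure// e !EFinM.
by rewrite !fineK ?fin_num_measure// muleA.
Qed.

(** Rectangles determine a product law. The law of (V, Z) restricted to
the event W in A and the scaled product law agree on rectangles, hence on all sets D; the
sets A x D then determine the law of (W, (V, Z)). *)
Lemma iid_normal3 (W V Z : Omega -> R) :
  measurable_fun [set: Omega] W -> measurable_fun [set: Omega] V ->
  measurable_fun [set: Omega] Z ->
  (forall a b c th, \int[P]_w cos (a * W w + b * V w + c * Z w + th) =
    expR (- (a ^+ 2 + b ^+ 2 + c ^+ 2) / 2) * cos th) ->
  forall S : set (mR * (mR * mR)), measurable S ->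
  P [set w | S (W w, (V w, Z w))] = (gam \x (gam \x gam))%E S.
Proof.
move=> mW mV mZ hyp S mS.
have rect := iid_normal3_rect mW mV mZ hyp.
have mVZ : measurable_fun [set: Omega] ((fun w => (V w, Z w)) : Omega -> (mR * mR)%type).
  exact: measurable_fun_pair.
have mWVZ : measurable_fun [set: Omega]
    ((fun w => (W w, (V w, Z w))) : Omega -> (mR * (mR * mR))%type).
  exact: measurable_fun_pair.
pose VZ : {mfun Omega >-> (mR * mR)%type} :=
  HB.pack (fun w => (V w, Z w)) (isMeasurableFun.Build _ _ _ _ _ mVZ).
pose WVZ : {mfun Omega >-> (mR * (mR * mR))%type} :=
  HB.pack (fun w => (W w, (V w, Z w))) (isMeasurableFun.Build _ _ _ _ _ mWVZ).
have step A (D : set (mR * mR)) : measurable A -> measurable D ->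
    P (W @^-1` A `&` VZ @^-1` D) = (gam A * (gam \x gam) D)%E.
  move=> mA mD.
  have mWA : measurable (W @^-1` A).
    by rewrite -[X in measurable X]setTI; exact: mW.
  have gA0 : 0 <= fine (gam A) by apply: fine_ge0; exact: measure_ge0.
  pose m1 := pushforward (mrestr P mWA) VZ.
  pose m2 := mscale (NngNum gA0) (gam \x gam)%E.
  have : m1 D = m2 D.
    apply: (@measure_unique _ _ (mR * mR)%type
      [set C | exists A', exists B', [/\ measurable A', measurable B' & C = A' `*` B']]
      (fun=> setT)) => //.
    - rewrite measurable_prod_measurableType; congr (<<s _ >>).
      apply/seteqP; split=> [C [A' mA' [B' mB' <-]]|C [A' [B' [mA' mB' ->]]]].
        by exists A', B'.
      by exists A' => //; exists B'.
    - move=> _ _ [A1 [B1 [mA1 mB1 ->]]] [A2 [B2 [mA2 mB2 ->]]].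
      exists (A1 `&` A2), (B1 `&` B2); split; [exact: measurableI|exact: measurableI|].
      by rewrite setXI.
    - by move=> _; exists setT, setT; rewrite setXTT; split.
    - by rewrite bigcup_const.
    - move=> _ [A1 [B1 [mA1 mB1 ->]]].
      rewrite -[LHS]/(P (VZ @^-1` (A1 `*` B1) `&` W @^-1` A)).
      rewrite -[RHS]/((fine (gam A))%:E * (gam \x gam)%E (A1 `*` B1))%E.
      by rewrite product_measure1E// fineK ?fin_num_measure// -rect// setIC.
    - move=> _; rewrite -[X in (X < _)%E]/(P (VZ @^-1` setT `&` W @^-1` A)).
      rewrite (le_lt_trans (probability_le1 _ _)) ?ltry//.
      by rewrite preimage_setT setTI.
  by rewrite /m1 /m2 /mscale/= /pushforward /mrestr/= fineK ?fin_num_measure// setIC.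
pose G1 : probability mR R := gam.
pose G2 : probability (mR * mR)%type R := (G1 \x G1)%E.
apply/esym; apply: (@product_measure_unique _ _ mR (mR * mR)%type R G1 G2 (distribution P WVZ)) => //.
Qed.

End iid_normal.

(** * Gaussian laws and their moments *)

Section same_law.
Context {R : realType} d1 d2 {T1 : measurableType d1} {T2 : measurableType d2}.
Context (P1 : {measure set T1 -> \bar R}) (P2 : {measure set T2 -> \bar R}).
Variables (U1 : T1 -> R) (U2 : T2 -> R).
Hypotheses (mU1 : measurable_fun [set: T1] U1) (mU2 : measurable_fun [set: T2] U2).
Hypothesis law : forall B : set R, measurable B -> P1 (U1 @^-1` B) = P2 (U2 @^-1` B).

Let ge0_integral_same_law (f : R -> \bar R) :
  measurable_fun [set: R] f -> (forall x, 0 <= f x)%E ->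
  (\int[P1]_w f (U1 w) = \int[P2]_w f (U2 w))%E.
Proof.
move=> mf f0.
have e1 := ge0_integral_pushforward mU1 P1 measurableT mf (fun y _ => f0 y).
have e2 := ge0_integral_pushforward mU2 P2 measurableT mf (fun y _ => f0 y).
rewrite !preimage_setT in e1 e2; rewrite -[LHS]e1 -[RHS]e2.
by apply: eq_measure_integral => A mA _; exact: law.
Qed.

Lemma integral_same_law (f : R -> R) : measurable_fun [set: R] f ->
  (\int[P1]_w (f (U1 w))%:E = \int[P2]_w (f (U2 w))%:E)%E.
Proof.
move=> mf; have mfE : measurable_fun [set: R] (EFin \o f) by exact/measurable_EFinP.
rewrite integralE [RHS]integralE; congr (_ - _)%E.
- have e (T : Type) (U : T -> R) x :
      ((fun x => (f (U x))%:E)^\+ x = (EFin \o f)^\+ (U x))%E by rewrite !funeposE.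
  under eq_integral do rewrite e; under [RHS]eq_integral do rewrite e.
  exact: (ge0_integral_same_law (measurable_funepos mfE) (funepos_ge0 _)).
- have e (T : Type) (U : T -> R) x :
      ((fun x => (f (U x))%:E)^\- x = (EFin \o f)^\- (U x))%E by rewrite !funenegE.
  under eq_integral do rewrite e; under [RHS]eq_integral do rewrite e.
  exact: (ge0_integral_same_law (measurable_funeneg mfE) (funeneg_ge0 _)).
Qed.

Lemma Rintegral_same_law (f : R -> R) : measurable_fun [set: R] f ->
  \int[P1]_w f (U1 w) = \int[P2]_w f (U2 w).
Proof. by move=> mf; rewrite /Rintegral integral_same_law. Qed.

Lemma integrable_same_law (f : R -> R) : measurable_fun [set: R] f ->
  P2.-integrable [set: T2] (EFin \o (f \o U2)) ->
  P1.-integrable [set: T1] (EFin \o (f \o U1)).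
Proof.
move=> mf /integrableP[_ fin]; apply/integrableP; split.
  by apply/measurable_EFinP; exact: measurableT_comp.
apply: le_lt_trans fin; rewrite le_eqVlt; apply/orP; left; apply/eqP.
by apply: (integral_same_law (f := fun x => `|f x|)); exact: measurableT_comp.
Qed.

End same_law.

Section gaussian_laws.
Context d {Omega : measurableType d} {R : realType} (P : probability Omega R).
Local Notation gam := (@normal_prob R 0 1).
Local Notation mR := (measurableTypeR R).

(** Gives the degenerate and the nondegenerate laws a common form, with s = 0 for the
point masses. *)
Lemma gaussian_law_affine (m : set R -> \bar R) : gaussian_law m ->
  exists a s, 0 <= s /\
    forall B : set R, measurable B -> m B = gam [set y | B (a + s * y)].
Proof.
case=> [[a [s [s0 h]]]|[a h]].
  exists a, s; split; first exact: ltW.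
  by move=> B mB; exact: etrans (h B mB) (normal_prob_affine _ s0 mB).
exists a, 0; split => // B mB; rewrite h// diracE.
have [aB|aB] := boolP (a \in B).
  rewrite (_ : [set y | _] = setT) ?probability_setT//.
  by apply/seteqP; split=> y //= _; rewrite mul0r addr0; exact: set_mem.
rewrite (_ : [set y | _] = set0) ?measure0//.
apply/seteqP; split=> y //=; rewrite mul0r addr0.
by move=> aB'; move: aB; rewrite mem_set.
Qed.

Lemma measurable_affine (a s : R) : measurable_fun [set: mR] ((fun y : R => a + s * y) : mR -> R).
Proof. by apply: measurable_funD => //; exact: measurable_funM. Qed.

Lemma integrable_std_normal_id : gam.-integrable [set: R] (EFin \o (fun x => x)).
Proof.
apply: (integrable_std_normal_sqr (C := 1) _ _).2 => // x.
by rewrite mul1r -(real_normK (num_real x)); have := normr_ge0 x; nra.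
Qed.

Lemma integrable_std_normal_expr2 : gam.-integrable [set: R] (EFin \o (fun x => x ^+ 2)).
Proof.
apply: (integrable_std_normal_sqr (C := 1) _ _).2; first exact: measurable_funX.
by move=> x; rewrite mul1r ger0_norm ?sqr_ge0// lerDr.
Qed.

Lemma gaussian_centered (U : Omega -> R) : measurable_fun [set: Omega] U ->
  gaussian_law (pushforward P U) -> \int[P]_w U w = 0 ->
  exists s, [/\ 0 <= s, forall B : set R, measurable B -> P (U @^-1` B) = gam [set y | B (s * y)],
    P.-integrable [set: Omega] (EFin \o (fun w => U w ^+ 2)) & \int[P]_w (U w ^+ 2) = s ^+ 2].
Proof.
move=> mU /gaussian_law_affine[a [s [s0 h]]] EU.
have maff := measurable_affine a s.
have a0 : a = 0.
  rewrite -[RHS]EU (Rintegral_same_law mU maff h (f := id))//.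
  rewrite RintegralD//; [|exact: finite_measure_integrable_cst|].
    rewrite RintegralZl//; last exact: integrable_std_normal_id.
    have g1 : fine (gam setT) = 1 by rewrite probability_setT.
    by rewrite mean_std_normal mulr0 addr0 Rintegral_cst// g1 mulr1.
  by have := integrableZl measurableT s integrable_std_normal_id.
rewrite {}a0 in h maff.
have h' (B : set R) : measurable B -> P (U @^-1` B) = gam [set y | B (s * y)].
  by move=> mB; rewrite -[LHS]/(pushforward P U B) h//; under eq_set do rewrite add0r.
have ms : measurable_fun [set: mR] ((fun y : R => s * y) : mR -> R) by exact: measurable_funM.
have i2 : gam.-integrable [set: R] (EFin \o (fun y => s ^+ 2 * y ^+ 2)).
  by have := integrableZl measurableT (s ^+ 2) integrable_std_normal_expr2.
exists s; split => //.
- apply: (integrable_same_law mU ms h' (f := fun x => x ^+ 2)); first exact: measurable_funX.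
  by apply: eq_integrable i2 => // y _ /=; rewrite exprMn.
- rewrite (Rintegral_same_law mU ms h' (f := fun x => x ^+ 2)); last exact: measurable_funX.
  under eq_Rintegral do rewrite exprMn.
  rewrite RintegralZl//; last exact: integrable_std_normal_expr2.
  by rewrite second_moment_std_normal mulr1.
Qed.

Lemma gaussian_centered_cos (U : Omega -> R) : measurable_fun [set: Omega] U ->
  gaussian_law (pushforward P U) -> \int[P]_w U w = 0 ->
  forall th, \int[P]_w cos (U w + th) = expR (- (\int[P]_w (U w ^+ 2)) / 2) * cos th.
Proof.
move=> mU gU EU th; have [s [s0 h _ ->]] := gaussian_centered mU gU EU.
have ms : measurable_fun [set: mR] ((fun y : R => s * y) : mR -> R) by exact: measurable_funM.
rewrite (Rintegral_same_law mU ms h (f := fun x => cos (x + th))).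
  exact: integral_cos_std_normal.
by apply: (measurableT_comp (@measurable_cos R)); exact: measurable_funD.
Qed.

(** Fubini for the product of the two laws. As the phase th is arbitrary, the inner integral
is again a cosine of the same kind. *)
Lemma indep_cos (A B : Omega -> R) (al be : R) :
  measurable_fun [set: Omega] A -> measurable_fun [set: Omega] B ->
  (forall C D : set R, measurable C -> measurable D ->
     P (A @^-1` C `&` B @^-1` D) = (P (A @^-1` C) * P (B @^-1` D))%E) ->
  (forall th, \int[P]_w cos (A w + th) = al * cos th) ->
  (forall th, \int[P]_w cos (B w + th) = be * cos th) ->
  forall th, \int[P]_w cos (A w + B w + th) = al * be * cos th.
Proof.
move=> mA mB indep cA cB th.
have mAB : measurable_fun [set: Omega] (fun w => (A w, B w)).
  exact: measurable_fun_pair.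
pose AB : {mfun Omega >-> (R * R)%type} :=
  HB.pack (fun w => (A w, B w)) (isMeasurableFun.Build _ _ _ _ _ mAB).
pose A' : {mfun Omega >-> R} := HB.pack A (isMeasurableFun.Build _ _ _ _ _ mA).
pose B' : {mfun Omega >-> R} := HB.pack B (isMeasurableFun.Build _ _ _ _ _ mB).
pose m1 : probability R R := distribution P A'.
pose m2 : probability R R := distribution P B'.
have mf : measurable_fun [set: R * R] (fun z : R * R => cos (z.1 + z.2 + th)).
  apply: (measurableT_comp (@measurable_cos R)).
  by do 2! apply: measurable_funD => //.
have ifm (m : probability (R * R)%type R) :
    m.-integrable [set: R * R] (fun z : R * R => (cos (z.1 + z.2 + th))%:E).
  apply: (@bounded_integrable _ _ _ m (fun z : R * R => cos (z.1 + z.2 + th)) 1) => // z.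
  exact: cos_max.
have mcB (y : R) : measurable_fun [set: R] (fun b => cos (b + y)).
  by apply: (measurableT_comp (@measurable_cos R)); exact: measurable_funD.
rewrite /Rintegral.
have -> : (\int[P]_w (cos (A w + B w + th))%:E =
    \int[distribution P AB]_z (cos (z.1 + z.2 + th))%:E)%E.
  rewrite integral_pushforward//.
  - exact/measurable_EFinP.
  - apply: (@bounded_integrable _ _ _ P (fun w => cos (A w + B w + th)) 1).
      exact: (measurableT_comp mf mAB).
    by move=> w; exact: cos_max.
have -> : (\int[distribution P AB]_z (cos (z.1 + z.2 + th))%:E =
    \int[(m1 \x m2)%E]_z (cos (z.1 + z.2 + th))%:E)%E.
  apply: eq_measure_integral => S mS _; apply/esym.
  by apply: product_measure_unique => // C D mC mD; rewrite -indep.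
rewrite -integral12_prod_meas1; last exact: ifm.
have E (a : R) : fubini_F m2 (fun z : R * R => (cos (z.1 + z.2 + th))%:E) a =
    (be * cos (a + th))%:E.
  rewrite -cB /fubini_F /=.
  rewrite /Rintegral fineK; last first.
    apply: integrable_fin_num => //; apply: (@bounded_integrable _ _ _ P _ 1).
      exact: (measurableT_comp (mcB _)).
    by move=> w; exact: cos_max.
  rewrite [LHS]integral_pushforward//.
  - by apply: eq_integral => w _ /=; congr (cos _)%:E; ring.
  - apply/measurable_EFinP; apply: (measurableT_comp (@measurable_cos R)).
    by do 2! apply: measurable_funD => //.
  - apply: (@bounded_integrable _ _ _ P (fun w => cos (a + B w + th)) 1).
      apply: (measurableT_comp (@measurable_cos R)).
      by do 2! apply: measurable_funD => //.
    by move=> w; exact: cos_max.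
under eq_integral do rewrite E.
rewrite -[LHS]/(\int[m1]_a (be * cos (a + th))).
rewrite RintegralZl//; last first.
  apply: (@bounded_integrable _ _ _ m1 (fun a => cos (a + th)) 1).
    exact: mcB.
  by move=> w; exact: cos_max.
have -> : \int[m1]_a cos (a + th) = \int[P]_w cos (A w + th).
  rewrite /Rintegral integral_pushforward//.
  - by apply/measurable_EFinP; exact: mcB.
  - apply: (@bounded_integrable _ _ _ P (fun w => cos (A w + th)) 1).
      exact: (measurableT_comp (mcB _)).
    by move=> w; exact: cos_max.
by rewrite cA; ring.
Qed.

End gaussian_laws.

(** * Covariance of a unit-variance Gaussian process *)

Section gaussian_process_pairs.
Context d {Omega : measurableType d} {R : realType} (P : probability Omega R).
Variable T : R.
Implicit Types X Y : R -> {RV P >-> R}.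

Lemma measurable_comb X (a b s t : R) :
  measurable_fun [set: Omega] (fun w => a * X s w + b * X t w).
Proof. by apply: measurable_funD; exact: measurable_funM. Qed.

Lemma gaussian_process_pair X (a b s t : R) : gaussian_process T X ->
  0 <= s <= T -> 0 <= t <= T ->
  gaussian_law (pushforward P (fun w => a * X s w + b * X t w)).
Proof.
move=> gX s0T t0T; have := gX 2 [tuple s; t] [tuple a; b].
rewrite (_ : (fun w => \sum_(i < 2) _) = (fun w => a * X s w + b * X t w)).
  by apply=> i; rewrite (tnth_nth 0); case: i => -[|[|//]].
by apply/funext => w; rewrite !big_ord_recl big_ord0 addr0 !(tnth_nth 0).
Qed.

Variable X : R -> {RV P >-> R}.
Hypotheses (gX : gaussian_process T X) (cX : centered T X) (vX : unit_variance T X).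

Lemma centered_Rintegral t : 0 <= t <= T -> \int[P]_w X t w = 0.
Proof. by move=> /cX; rewrite unlock /Rintegral => ->. Qed.

Let sqr_facts t : 0 <= t <= T ->
  P.-integrable [set: Omega] (EFin \o (fun w => X t w ^+ 2)) /\ \int[P]_w (X t w ^+ 2) = 1.
Proof.
move=> t0T.
have mXt : measurable_fun [set: Omega] (X t) by [].
have gXt : gaussian_law (pushforward P (X t)).
  have := gaussian_process_pair 1 0 gX t0T t0T.
  rewrite (_ : (fun w => _) = X t)//.
  by apply/funext => w; rewrite mul1r mul0r addr0.
have [s [_ _ i2 e2]] := gaussian_centered mXt gXt (centered_Rintegral t0T).
split => //.
have := vX t0T; rewrite /variance unlock (cX t0T) /= unlock.
rewrite /Rintegral => h; rewrite -[RHS]/(fine 1%E) -h; congr fine.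
by apply: eq_integral => w _; rewrite -[RHS]/(((X t w - 0) * (X t w - 0))%:E) !subr0.
Qed.

Lemma integrable_sqr t : 0 <= t <= T ->
  P.-integrable [set: Omega] (EFin \o (fun w => X t w ^+ 2)).
Proof. by move=> /sqr_facts[]. Qed.

Lemma unit_second_moment t : 0 <= t <= T -> \int[P]_w (X t w ^+ 2) = 1.
Proof. by move=> /sqr_facts[]. Qed.

Lemma integrable_RV t : 0 <= t <= T -> P.-integrable [set: Omega] (EFin \o X t).
Proof.
move=> t0T; apply: (@integrable_dominated _ _ _ _ _ (fun w => 1 + X t w ^+ 2)) => //.
  by move=> w; rewrite -(real_normK (num_real (X t w))); have := normr_ge0 (X t w); nra.
have := integrableD measurableT (finite_measure_integrable_cst P 1 measurableT) (integrable_sqr t0T).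
by [].
Qed.

Lemma integrable_mul s t : 0 <= s <= T -> 0 <= t <= T ->
  P.-integrable [set: Omega] (EFin \o (fun w => X s w * X t w)).
Proof.
move=> s0T t0T.
apply: (@integrable_dominated _ _ _ _ _ (fun w => X s w ^+ 2 + X t w ^+ 2)).
- exact: measurable_funM.
- move=> w; rewrite normrM -(real_normK (num_real (X s w))) -(real_normK (num_real (X t w))).
  by have := normr_ge0 (X s w); have := normr_ge0 (X t w); nra.
- exact: integrableD (integrable_sqr s0T) (integrable_sqr t0T).
Qed.

Definition acov (s t : R) := \int[P]_w (X s w * X t w).

(** The acov s t of a centered process with unit variance is its correlation; together with the
Gaussian property it determines all integrals of cos (a X(s) + b X(t) + th). *)
Lemma second_moment_comb (a b s t : R) : 0 <= s <= T -> 0 <= t <= T ->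
  \int[P]_w ((a * X s w + b * X t w) ^+ 2) = a ^+ 2 + b ^+ 2 + 2 * a * b * acov s t.
Proof.
move=> s0T t0T.
have i1 := integrableZl measurableT (a ^+ 2) (integrable_sqr s0T).
have i2 := integrableZl measurableT (b ^+ 2) (integrable_sqr t0T).
have i3 := integrableZl measurableT (2 * a * b) (integrable_mul s0T t0T).
rewrite (@eq_Rintegral _ _ _ _ _ (fun w =>
  (a ^+ 2 * X s w ^+ 2 + b ^+ 2 * X t w ^+ 2) + 2 * a * b * (X s w * X t w)));
  last by move=> w _; ring.
rewrite RintegralD//; last exact: integrableD i1 i2.
rewrite RintegralD// !RintegralZl//.
- by rewrite !unit_second_moment// !mulr1.
- exact: integrable_mul.
- exact: integrable_sqr.
- exact: integrable_sqr.
Qed.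

Lemma cos_comb (a b s t th : R) : 0 <= s <= T -> 0 <= t <= T ->
  \int[P]_w cos (a * X s w + b * X t w + th) =
  expR (- (a ^+ 2 + b ^+ 2 + 2 * a * b * acov s t) / 2) * cos th.
Proof.
move=> s0T t0T; rewrite -second_moment_comb//.
apply: (gaussian_centered_cos (U := fun w => a * X s w + b * X t w)).
- exact: measurable_comb.
- exact: gaussian_process_pair.
- have i1 := integrableZl measurableT a (integrable_RV s0T).
  have i2 := integrableZl measurableT b (integrable_RV t0T).
  rewrite RintegralD// !RintegralZl//; try exact: integrable_RV.
  by rewrite !centered_Rintegral// !mulr0 addr0.
Qed.

Lemma acov_itv s t : 0 <= s <= T -> 0 <= t <= T -> -1 <= acov s t <= 1.
Proof.
move=> s0T t0T.
have h (b : R) : 0 <= 1 ^+ 2 + b ^+ 2 + 2 * 1 * b * acov s t.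
  by rewrite -second_moment_comb//; apply: Rintegral_ge0 => w _; exact: sqr_ge0.
by have := h 1; have := h (-1); lra.
Qed.

End gaussian_process_pairs.

Section same_covariance.
Context d {Omega : measurableType d} {R : realType} (P : probability Omega R).
Variable T : R.

Lemma measurable_tuple_comb (a b : R) (C : set R) : measurable C ->
  measurable [set x : 2.-tuple R | C (a * tnth x ord0 + b * tnth x ord_max)].
Proof.
move=> mC.
have mf : measurable_fun [set: 2.-tuple R]
    (fun x : 2.-tuple R => a * tnth x ord0 + b * tnth x ord_max).
  by apply: measurable_funD; apply: measurable_funM => //; exact: measurable_tnth.
by rewrite -[X in measurable X]setTI; exact: mf.
Qed.

Lemma fdd_pair (X : R -> {RV P >-> R}) (s t a b : R) (C : set R) :
  fdd X [tuple s; t] [set x : 2.-tuple R | C (a * tnth x ord0 + b * tnth x ord_max)] =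
  P [set w | C (a * X s w + b * X t w)].
Proof.
rewrite /fdd /pushforward; congr (P _); apply/seteqP; split=> w /=;
  by rewrite !tnth_mktuple !(tnth_nth 0).
Qed.

(** The covariance is read off the second moment of X(s) + X(t), which is an integral against
a finite-dimensional law. *)
Lemma acov_same_fdd (X Y : R -> {RV P >-> R}) (s t : R) :
  gaussian_process T X -> centered T X -> unit_variance T X ->
  gaussian_process T Y -> centered T Y -> unit_variance T Y ->
  same_fdd T X Y -> 0 <= s <= T -> 0 <= t <= T -> acov X s t = acov Y s t.
Proof.
move=> gX cX vX gY cY vY XY s0T t0T.
have e1 := second_moment_comb gX cX vX 1 1 s0T t0T.
have e2 := second_moment_comb gY cY vY 1 1 s0T t0T.
suff : \int[P]_w ((1 * X s w + 1 * X t w) ^+ 2) = \int[P]_w ((1 * Y s w + 1 * Y t w) ^+ 2).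
  by rewrite e1 e2; lra.
apply: (@Rintegral_same_law _ _ _ _ _ P P (fun w => 1 * X s w + 1 * X t w)
  (fun w => 1 * Y s w + 1 * Y t w) _ _ _ (fun x => x ^+ 2)).
- exact: measurable_comb.
- exact: measurable_comb.
- move=> B mB; rewrite -[LHS](fdd_pair X s t 1 1) -[RHS](fdd_pair Y s t 1 1).
  apply: XY; last exact: measurable_tuple_comb.
  by move=> i; rewrite (tnth_nth 0); case: i => -[|[|//]].
- exact: measurable_funX.
Qed.

Lemma acov_stationary (X : R -> {RV P >-> R}) (t h : R) :
  gaussian_process T X -> centered T X -> unit_variance T X -> stationary T X ->
  0 <= h -> 0 <= t -> t + h <= T -> acov X t (t + h) = acov X 0 h.
Proof.
move=> gX cX vX sX h0 t0 thT.
have i0 : 0 <= (0 : R) <= T by rewrite lexx/=; lra.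
have ih : 0 <= h <= T by apply/andP; split; lra.
have it : 0 <= t <= T by apply/andP; split; lra.
have ith : 0 <= t + h <= T by apply/andP; split; lra.
have e1 := second_moment_comb gX cX vX 1 1 it ith.
have e2 := second_moment_comb gX cX vX 1 1 i0 ih.
suff : \int[P]_w ((1 * X t w + 1 * X (t + h) w) ^+ 2) = \int[P]_w ((1 * X 0 w + 1 * X h w) ^+ 2).
  by rewrite e1 e2; lra.
apply: (@Rintegral_same_law _ _ _ _ _ P P (fun w => 1 * X t w + 1 * X (t + h) w)
  (fun w => 1 * X 0 w + 1 * X h w) _ _ _ (fun x => x ^+ 2)).
- exact: measurable_comb.
- exact: measurable_comb.
- move=> B mB; rewrite -[LHS](fdd_pair X t (t + h) 1 1) -[RHS](fdd_pair X 0 h 1 1).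
  rewrite -(sX 2 [tuple 0; h] t); last exact: measurable_tuple_comb.
  + suff -> : [tuple t; t + h] = [tuple tnth [tuple 0; h] i + t | i < 2] by [].
    apply: eq_from_tnth => i; rewrite tnth_mktuple !(tnth_nth 0).
    by case: i => -[|[|//]] /= _; rewrite ?add0r // addrC.
  + by move=> i; rewrite (tnth_nth 0); case: i => -[|[|//]].
  + by move=> i; rewrite (tnth_nth 0); case: i => -[|[|//]] /= _; rewrite ?add0r // addrC.
- exact: measurable_funX.
Qed.

Lemma path_measurable_comb (X : R -> {RV P >-> R}) (s t a b : R) (C : set R) :
  0 <= s <= T -> 0 <= t <= T -> measurable C ->
  path_sigma_algebra T X [set w | C (a * X s w + b * X t w)].
Proof.
move=> s0T t0T mC; rewrite /path_sigma_algebra; set G := [set A | _].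
pose Om := g_sigma_algebraType G.
have mX r : 0 <= r <= T -> measurable_fun [set: Om] (X r : Om -> R).
  move=> r0T _ B mB; rewrite setTI; apply: sub_sigma_algebra.
  by exists r, B.
have mf : measurable_fun [set: Om] ((fun w => a * X s w + b * X t w) : Om -> R).
  by apply: measurable_funD; apply: measurable_funM => //; exact: mX.
by have := mf measurableT C mC; rewrite setTI.
Qed.

Lemma cos_joint (X Y : R -> {RV P >-> R}) (s t a b a' b' th : R) :
  gaussian_process T X -> centered T X -> unit_variance T X ->
  gaussian_process T Y -> centered T Y -> unit_variance T Y ->
  same_fdd T X Y -> independent_processes T X Y -> 0 <= s <= T -> 0 <= t <= T ->
  \int[P]_w cos (a * X s w + b * X t w + (a' * Y s w + b' * Y t w) + th) =
  expR (- (a ^+ 2 + b ^+ 2 + 2 * a * b * acov X s t +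
    (a' ^+ 2 + b' ^+ 2 + 2 * a' * b' * acov X s t)) / 2) * cos th.
Proof.
move=> gX cX vX gY cY vY XY iXY s0T t0T.
rewrite opprD mulrDl expRD.
apply: (@indep_cos _ _ _ P (fun w => a * X s w + b * X t w) (fun w => a' * Y s w + b' * Y t w)).
- exact: measurable_comb.
- exact: measurable_comb.
- by move=> C D mC mD; apply: iXY; exact: path_measurable_comb.
- by move=> t'; rewrite (cos_comb gX cX vX).
- by move=> t'; rewrite (cos_comb gY cY vY)// (acov_same_fdd gX cX vX gY cY vY XY).
Qed.

End same_covariance.

(** * The Gaussian estimate for one upcrossing *)

Lemma measurable_fun_triple d (Omega : measurableType d) (R : realType)
    (W V Z : Omega -> R) :
  measurable_fun [set: Omega] W -> measurable_fun [set: Omega] V ->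
  measurable_fun [set: Omega] Z -> measurable_fun [set: Omega]
    ((fun w => (W w, (V w, Z w))) :
       Omega -> (measurableTypeR R * (measurableTypeR R * measurableTypeR R))%type).
Proof.
move=> mW mV mZ.
have mVZ : measurable_fun [set: Omega]
    ((fun w => (V w, Z w)) : Omega -> (measurableTypeR R * measurableTypeR R)%type).
  exact: measurable_fun_pair.
exact: measurable_fun_pair.
Qed.

Section crossing.
Context {R : realType}.
Local Notation gam := (@normal_prob R 0 1).
Local Notation mR := (measurableTypeR R).
Local Notation phi := (@std_normal_pdf R).

(** For r > 0, if r v - sqrt (1 - r^2) w <= u then v <= u + lag r u w:
this is how far above u the process can be after a step of correlation r that starts
below u. *)
Definition lag (r u w : R) : R := ((1 - r) * u + Num.sqrt (1 - r ^+ 2) * Num.max w 0) / r.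

(** An upper bound of the mean, over a standard normal W, of phi(u) l (Phibar(c u) + k l)
with l = lag r u W: the first summand comes from E W^+ = 1 / sqrt (2 pi), the second
one, quadratic in l, from [lag_sqr_le] and E W^2 = 1. *)
Definition crossing_bound (rho u r : R) : R :=
  let k := `|rho| / Num.sqrt (1 - rho ^+ 2) in
  let c := Num.sqrt ((1 - rho) / (1 + rho)) in
  phi u * (std_normal_tail (c * u) *
             (((1 - r) * u + Num.sqrt (1 - r ^+ 2) / Num.sqrt (2 * pi)) / r)
           + k * (2 * ((1 - r) ^+ 2 * u ^+ 2 + (1 - r ^+ 2)) / r ^+ 2)).

Lemma crossing_bound_ge0 (rho u r : R) : 0 <= u -> 0 < r <= 1 ->
  0 <= crossing_bound rho u r.
Proof.
move=> u0 /andP[r0 r1].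
have rr : 0 <= 1 - r ^+ 2 by nra.
rewrite /crossing_bound mulr_ge0 ?std_normal_pdf_ge0// addr_ge0//.
- rewrite mulr_ge0 ?std_normal_tail_ge0// divr_ge0 ?(ltW r0)// addr_ge0//.
  by rewrite mulr_ge0// subr_ge0.
- rewrite mulr_ge0// ?divr_ge0 ?sqr_ge0// mulr_ge0// addr_ge0//.
  by rewrite mulr_ge0 ?sqr_ge0.
Qed.

Lemma lag_ge0 (r u w : R) : 0 <= u -> 0 < r <= 1 -> 0 <= lag r u w.
Proof.
move=> u0 /andP[r0 r1]; rewrite /lag divr_ge0 ?(ltW r0)// addr_ge0//.
  by rewrite mulr_ge0// subr_ge0.
by rewrite mulr_ge0// le_max lexx orbT.
Qed.

Lemma measurable_lag (r u : R) : measurable_fun [set: R] (lag r u).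
Proof.
apply: measurable_funM => //; apply: measurable_funD => //.
by apply: measurable_funM => //; exact: measurable_funrpos.
Qed.

Lemma lag_sqr_le (r u w : R) : 0 < r <= 1 ->
  lag r u w ^+ 2 <= 2 * ((1 - r) ^+ 2 * u ^+ 2 + (1 - r ^+ 2) * w ^+ 2) / r ^+ 2.
Proof.
move=> /andP[r0 r1]; have rr : 0 <= 1 - r ^+ 2 by nra.
rewrite /lag exprMn exprVn ler_pM2r ?invr_gt0 ?exprn_gt0//.
set a := (1 - r) * u; set s := Num.sqrt _; set m := Num.max w 0.
have mw : m ^+ 2 <= w ^+ 2.
  rewrite /m; case: (leP w 0) => _; last by [].
  by rewrite expr0n sqr_ge0.
have s2 : s ^+ 2 = 1 - r ^+ 2 by rewrite sqr_sqrtr.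
rewrite -s2 -exprMn -/a.
have : s ^+ 2 * m ^+ 2 <= s ^+ 2 * w ^+ 2 by rewrite ler_wpM2l// sqr_ge0.
by have := sqr_ge0 (a - s * m); rewrite sqrrB sqrrD exprMn; lra.
Qed.

(** The triples (w, (v, z)) of values of the independent variables W, V, Z at an upcrossing:
the last condition is what remains of rho v + sqrt (1 - rho^2) z > u when v is only
known to lie between u and u + lag r u w. *)
Definition crossing_set (rho u r : R) : set (mR * (mR * mR)) :=
  [set x | [/\ u < x.2.1, x.2.1 <= u + lag r u x.1 &
    Num.sqrt ((1 - rho) / (1 + rho)) * u -
      `|rho| / Num.sqrt (1 - rho ^+ 2) * lag r u x.1 < x.2.2]].

Lemma measurable_crossing_set (rho u r : R) : measurable (crossing_set rho u r).
Proof.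
set c := Num.sqrt ((1 - rho) / (1 + rho)) * u.
set k := `|rho| / Num.sqrt (1 - rho ^+ 2).
have m1 : measurable_fun [set: (mR * (mR * mR))%type] (fun x : mR * (mR * mR) => lag r u x.1).
  exact: (measurableT_comp (measurable_lag r u) measurable_fst).
have m21 : measurable_fun [set: (mR * (mR * mR))%type] (fun x : mR * (mR * mR) => x.2.1 : R).
  exact: (measurableT_comp measurable_fst measurable_snd).
have m22 : measurable_fun [set: (mR * (mR * mR))%type] (fun x : mR * (mR * mR) => x.2.2 : R).
  exact: (measurableT_comp measurable_snd measurable_snd).
rewrite (_ : crossing_set rho u r =
  (fun x : mR * (mR * mR) => u < x.2.1) @^-1` [set true] `&`
  ((fun x : mR * (mR * mR) => x.2.1 <= u + lag r u x.1) @^-1` [set true] `&`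
   (fun x : mR * (mR * mR) => c - k * lag r u x.1 < x.2.2) @^-1` [set true])); last first.
  by apply/seteqP; split=> [x [h1 h2 h3]|x [h1 [h2 h3]]].
have h (f : mR * (mR * mR) -> bool) : measurable_fun setT f -> measurable (f @^-1` [set true]).
  by move=> mf; rewrite -[X in measurable X]setTI; exact: mf.
apply: measurableI; [|apply: measurableI]; apply: h.
- exact: measurable_fun_ltr.
- by apply: measurable_fun_ler => //; exact: measurable_funD.
- apply: measurable_fun_ltr => //; apply: measurable_funB => //.
  exact: measurable_funM.
Qed.

Let integral_quadratic (K0 K1 K2 : R) :
  let g := fun w : R => K0 + (K1 * Num.max w 0 + K2 * w ^+ 2) in
  gam.-integrable [set: R] (EFin \o g) /\
  \int[gam]_w g w = K0 + (K1 / Num.sqrt (2 * pi) + K2).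
Proof.
move=> g.
have im : gam.-integrable [set: R] (EFin \o (fun w => Num.max w 0)).
  apply: (integrable_std_normal_sqr (C := 1) _ _).2; first exact: measurable_funrpos.
  move=> x; rewrite mul1r ger0_norm ?le_max ?lexx ?orbT//.
  by case: (leP x 0) => h; nra.
have i1 := integrableZl measurableT K1 im.
have i2 := integrableZl measurableT K2 (@integrable_std_normal_expr2 R).
have i12 := integrableD measurableT i1 i2.
have i0 := finite_measure_integrable_cst
  (gam : {finite_measure set mR -> \bar R}) K0 measurableT.
split; first by have := integrableD measurableT i0 i12.
rewrite RintegralD// RintegralD// !RintegralZl//; last exact: integrable_std_normal_expr2.
have g1 : fine (gam setT) = 1 by rewrite probability_setT.
rewrite second_moment_std_normal Rintegral_cst// g1 !mulr1.
have -> : \int[gam]_w Num.max w 0 = (Num.sqrt (2 * pi))^-1.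
  by rewrite /Rintegral mean_pos_part_std_normal.
by [].
Qed.

(** The section of the set at w is a product of an interval and a ray. The interval has length
lag r u w and the density on it is at most phi(u); the tail at c u - k l exceeds the tail
at c u by at most k l. *)
Lemma crossing_set_prob (rho u r : R) : 0 <= u -> 0 < r <= 1 ->
  ((gam \x (gam \x gam)) (crossing_set rho u r) <= (crossing_bound rho u r)%:E)%E.
Proof.
move=> u0 r01; have /andP[r0 r1] := r01.
have rr : 0 <= 1 - r ^+ 2 by nra.
rewrite -[X in (X <= _)%E]/(\int[gam]_w (gam \x gam)%E
  (xsection (crossing_set rho u r) w))%E.
set c := Num.sqrt ((1 - rho) / (1 + rho)).
set k := `|rho| / Num.sqrt (1 - rho ^+ 2).
have k0 : 0 <= k by rewrite divr_ge0.
set s := Num.sqrt (1 - r ^+ 2).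
(* The coefficients of 1, W^+ and W^2 in the bound to be averaged. *)
pose K0 := phi u * (std_normal_tail (c * u) / r) * ((1 - r) * u) +
  phi u * (k * (2 * ((1 - r) ^+ 2 * u ^+ 2) / r ^+ 2)).
pose K1 := phi u * (std_normal_tail (c * u) / r) * s.
pose K2 := phi u * (k * (2 * (1 - r ^+ 2) / r ^+ 2)).
pose g (w : R) := K0 + (K1 * Num.max w 0 + K2 * w ^+ 2).
have [ig Ig0] := integral_quadratic K0 K1 K2.
have Ig : \int[gam]_w g w = crossing_bound rho u r.
  rewrite Ig0.
  rewrite /crossing_bound -/c -/k -/s /K0 /K1 /K2.
  set q := Num.sqrt (2 * pi); set t := std_normal_tail _.
  by field; rewrite gt_eqF//= gt_eqF// sqrtr_gt0 mulr_gt0// pi_gt0.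
rewrite -Ig /Rintegral fineK; last exact: integrable_fin_num.
apply: ge0_le_integral => //.
- pose G1 : probability mR R := gam.
  pose G2 : probability (mR * mR)%type R := (G1 \x G1)%E.
  exact: (@measurable_fun_xsection _ _ mR (mR * mR)%type R G2 _
    (measurable_crossing_set rho u r)).
- exact: (measurable_int _ ig).
move=> w _.
have L0 := lag_ge0 w u0 r01.
rewrite [xsection _ _](_ : _ = `]u, u + lag r u w] `*` `]c * u - k * lag r u w, +oo[); last first.
  apply/seteqP; split=> -[v z]; rewrite /xsection/= inE /crossing_set/= !in_itv/= andbT.
    by move=> [-> -> ->].
  by move=> [/andP[-> ->] ->].
rewrite product_measure1E//= normal_prob_tail.
have b1 : (gam `]u, (u + lag r u w)%R] <= (phi u * lag r u w)%:E)%E.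
  have := @normal_prob_itv_le R u (u + lag r u w) (phi u).
  rewrite lerDl addrAC subrr add0r; apply => //.
  by move=> x ux; exact: std_normal_pdf_nonincreasing.
apply: (@le_trans _ _ ((phi u * lag r u w)%:E * (std_normal_tail (c * u) + k * lag r u w)%:E)%E).
  apply: lee_pmul => //; first by rewrite lee_fin std_normal_tail_ge0.
  by rewrite lee_fin std_normal_tailB_le// mulr_ge0.
rewrite -EFinM lee_fin /g /K0 /K1 /K2.
have lq := lag_sqr_le u w r01.
have le : lag r u w = ((1 - r) * u + s * Num.max w 0) / r by [].
have p0 := std_normal_pdf_ge0 u.
apply: (@le_trans _ _ (phi u * (std_normal_tail (c * u) * (((1 - r) * u + s * Num.max w 0) / r)
  + k * (2 * ((1 - r) ^+ 2 * u ^+ 2 + (1 - r ^+ 2) * w ^+ 2) / r ^+ 2)))).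
  rewrite -le.
  have := ler_wpM2l p0 (ler_wpM2l k0 lq).
  move: (lag r u w) (_ / r ^+ 2) (std_normal_tail _) => L q t.
  have -> : phi u * L * (t + k * L) = phi u * (t * L) + phi u * (k * L ^+ 2) by ring.
  by rewrite mulrDr lerD2l.
rewrite le_eqVlt; apply/orP; left; apply/eqP.
by move: (Num.max w 0) => m; ring.
Qed.

End crossing.

(** * Upcrossings and joint exceedances of a rotated pair of processes *)

Section order_sets.
Context d {Omega : measurableType d} {R : realType}.

Lemma measurable_lt_set (f g : Omega -> R) : measurable_fun [set: Omega] f ->
  measurable_fun [set: Omega] g -> measurable [set w | f w < g w].
Proof.
move=> mf mg; have := measurable_fun_ltr mf mg.
move=> /(_ measurableT [set true] I); rewrite setTI.
by rewrite (_ : _ @^-1` _ = [set w | f w < g w])//; apply/seteqP; split.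
Qed.

Lemma measurable_le_set (f g : Omega -> R) : measurable_fun [set: Omega] f ->
  measurable_fun [set: Omega] g -> measurable [set w | f w <= g w].
Proof.
move=> mf mg; have := measurable_fun_ler mf mg.
move=> /(_ measurableT [set true] I); rewrite setTI.
by rewrite (_ : _ @^-1` _ = [set w | f w <= g w])//; apply/seteqP; split.
Qed.

End order_sets.

(** On the line v = rho v + sqrt (1 - rho^2) z the slope z / v is (1 - rho) / sqrt (1 - rho^2),
which is the constant in the tail functions. *)
Lemma rotation_slope (R : realType) (rho : R) : -1 < rho < 1 ->
  Num.sqrt ((1 - rho) / (1 + rho)) * Num.sqrt (1 - rho ^+ 2) = 1 - rho.
Proof.
move=> /andP[rho1 rho2].
have r1 : 0 < 1 - rho by lra.
have r2 : 0 < 1 + rho by lra.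
rewrite -sqrtrM ?divr_ge0 ?(ltW r1) ?(ltW r2)//.
rewrite (_ : (1 - rho) / (1 + rho) * (1 - rho ^+ 2) = (1 - rho) ^+ 2).
  by rewrite sqrtr_sqr gtr0_norm.
by field; rewrite gt_eqF.
Qed.

Definition joint_tail {R : realType} (c u : R) : R :=
  \int[lebesgue_measure]_(x in `[u, +oo[) (std_normal_pdf x * std_normal_tail (c * x)).

(** The pair (A, B) is the image of (X, Y) under an orthogonal matrix with rows (p, q) and
(p', q'). The identity matrix gives the components X1 and Y; the matrix with rows
(rho, sqrt (1 - rho^2)) and (sqrt (1 - rho^2), - rho) makes A the second component X2,
with X1 = rho A + sqrt (1 - rho^2) B. *)
Section rotated_pair.
Context d {Omega : measurableType d} {R : realType} (P : probability Omega R).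
Variables (T : R) (X Y : R -> {RV P >-> R}).
Hypotheses (gX : gaussian_process T X) (cX : centered T X) (vX : unit_variance T X).
Hypotheses (gY : gaussian_process T Y) (cY : centered T Y) (vY : unit_variance T Y).
Hypotheses (XY : same_fdd T X Y) (iXY : independent_processes T X Y).
Local Notation gam := (@normal_prob R 0 1).
Local Notation mR := (measurableTypeR R).

Variables (p q p' q' : R).
Hypotheses (pq1 : p ^+ 2 + q ^+ 2 = 1) (pq1' : p' ^+ 2 + q' ^+ 2 = 1).
Hypothesis pq0 : p * p' + q * q' = 0.

Let A t w := p * X t w + q * Y t w.
Let B t w := p' * X t w + q' * Y t w.

Let mA t : measurable_fun [set: Omega] (A t).
Proof. by apply: measurable_funD; exact: measurable_funM. Qed.

Let mB t : measurable_fun [set: Omega] (B t).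
Proof. by apply: measurable_funD; exact: measurable_funM. Qed.

(** The increment is then a Gaussian variable of variance 0. *)
Lemma as_equal_of_acov1 (Q : R -> {RV P >-> R}) s t :
  gaussian_process T Q -> centered T Q -> unit_variance T Q ->
  0 <= s <= T -> 0 <= t <= T -> acov Q s t = 1 -> P [set w | Q s w != Q t w] = 0%E.
Proof.
move=> gQ cQ vQ s0T t0T r1.
have mU := measurable_comb Q 1 (-1) s t.
have EU : \int[P]_w (1 * Q s w + -1 * Q t w) = 0.
  have i1 := integrableZl measurableT 1 (integrable_RV gQ cQ vQ s0T).
  have i2 := integrableZl measurableT (-1) (integrable_RV gQ cQ vQ t0T).
  rewrite RintegralD// !RintegralZl//; try exact: (integrable_RV gQ cQ vQ).
  by rewrite !(centered_Rintegral cQ)// !mulr0 addr0.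
have [sg [_ law _]] := gaussian_centered mU (gaussian_process_pair 1 (-1) gQ s0T t0T) EU.
rewrite (second_moment_comb gQ cQ vQ)// r1 => sg2.
have sg0 : sg = 0 by apply/eqP; rewrite -sqrf_eq0 -sg2; apply/eqP; ring.
have mC : measurable (~` [set (0 : R)]) by apply: measurableC; exact: measurable_set1.
have := law _ mC.
rewrite (_ : [set y | _] = set0) ?measure0; last first.
  by apply/seteqP; split=> y //=; rewrite sg0 mul0r.
rewrite (_ : _ @^-1` _ = [set w | Q s w != Q t w])//.
apply/seteqP; split=> w /=; rewrite mul1r mulN1r.
  by move=> h; apply/eqP => e; apply: h; rewrite e subrr.
by move=> /eqP h /eqP; rewrite subr_eq0 => /eqP.
Qed.

(** Let r = acov X s t. If r < 1, the variables W = (r A(t) - A(s)) / sqrt (1 - r^2), A(t) and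
B(t) are independent standard normal, and the event forces them into [crossing_set].
If r = 1, almost surely no crossing takes place. *)
Lemma crossing_prob (rho u s t : R) : -1 < rho < 1 -> 0 < u ->
  0 <= s <= T -> 0 <= t <= T -> 0 < acov X s t ->
  (P [set w | [/\ (A s w <= u)%R, (u < A t w)%R &
                  (u < rho * A t w + Num.sqrt (1 - rho ^+ 2) * B t w)%R]]
   <= (crossing_bound rho u (acov X s t))%:E)%E.
Proof.
move=> /andP[rho1 rho2] u0 s0T t0T r0.
have /andP[_ r1] := acov_itv gX cX vX s0T t0T.
set r := acov X s t in r0 r1 *.
have r01 : 0 < r <= 1 by apply/andP.
set E := [set w | _].
have mE : measurable E.
  rewrite (_ : E = [set w | A s w <= u] `&` ([set w | u < A t w] `&`
     [set w | u < rho * A t w + Num.sqrt (1 - rho ^+ 2) * B t w])); last first.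
    by apply/seteqP; split=> w /= [h1 h2]; [move=> h3; split|case: h2 => h2 h3; split].
  apply: measurableI; first exact: measurable_le_set.
  apply: measurableI; first exact: measurable_lt_set.
  by apply: measurable_lt_set => //; apply: measurable_funD; exact: measurable_funM.
have [re1|rn1] := eqVneq r 1.
  apply: (@le_trans _ _ 0%E); last first.
    by rewrite lee_fin; apply: crossing_bound_ge0 => //; exact: ltW.
  have eX := as_equal_of_acov1 gX cX vX s0T t0T re1.
  have eY : P [set w | Y s w != Y t w] = 0%E.
    by apply: as_equal_of_acov1 => //; rewrite -(acov_same_fdd gX cX vX gY cY vY XY).
  have mn (Q : R -> {RV P >-> R}) : measurable [set w | Q s w != Q t w].
    rewrite (_ : [set w | _] = ~` ([set w | Q s w <= Q t w] `&` [set w | Q t w <= Q s w])).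
      by apply: measurableC; apply: measurableI; exact: measurable_le_set.
    apply/seteqP; split=> w /=; first by move=> /eqP h [h1 h2]; apply: h; apply/eqP; rewrite eq_le h1.
    by move=> h; apply/eqP => e; apply: h; rewrite e lexx.
  apply: (@le_trans _ _ (P ([set w | X s w != X t w] `|` [set w | Y s w != Y t w]))).
    apply: le_measure; rewrite ?inE//; first by apply: measurableU.
    move=> w [h1 h2 _]; have [e1|e1] := eqVneq (X s w) (X t w); last by left.
    have [e2|e2] := eqVneq (Y s w) (Y t w); last by right.
    by move: (le_lt_trans h1 h2); rewrite /A e1 e2 ltxx.
  by rewrite (le_trans (measureU2 _ _ _))// [X in (_ + X)%E]eY [X in (X + _)%E]eX adde0.
have rlt1 : r < 1 by rewrite lt_neqAle rn1.
have rr : 0 < 1 - r ^+ 2 by nra.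
set sd := Num.sqrt (1 - r ^+ 2).
have sd0 : 0 < sd by rewrite sqrtr_gt0.
have sd2 : sd ^+ 2 = 1 - r ^+ 2 by rewrite sqr_sqrtr// ltW.
pose W w := (r * A t w - A s w) / sd.
have mW : measurable_fun [set: Omega] W.
  by apply: measurable_funM => //; apply: measurable_funB => //; exact: measurable_funM.
rewrite (le_trans _ (crossing_set_prob rho (ltW u0) r01))//.
rewrite -(@iid_normal3 _ _ _ P W (A t) (B t))//; last 2 first.
- move=> a b c th.
  (* The coefficients of A s and A t in a W + b A(t). *)
  pose al := - a / sd; pose be := a * r / sd + b.
  rewrite (@eq_Rintegral _ _ _ _ _ (fun w => cos (al * p * X s w + (be * p + c * p') * X t w +
    (al * q * Y s w + (be * q + c * q') * Y t w) + th))); last first.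
    by move=> w _; congr cos; rewrite /W /A /B /al /be; ring.
  rewrite (cos_joint _ _ _ _ _ gX cX vX gY cY vY XY iXY s0T t0T) -/r.
  congr (expR _ * _); congr (- _ / _).
  have -> : (al * p) ^+ 2 + (be * p + c * p') ^+ 2 + 2 * (al * p) * (be * p + c * p') * r +
     ((al * q) ^+ 2 + (be * q + c * q') ^+ 2 + 2 * (al * q) * (be * q + c * q') * r) =
     (al ^+ 2 + be ^+ 2 + 2 * al * be * r) * (p ^+ 2 + q ^+ 2) +
     c ^+ 2 * (p' ^+ 2 + q' ^+ 2) + 2 * c * (be + al * r) * (p * p' + q * q') by ring.
  rewrite pq1 pq1' pq0 mulr0 addr0 !mulr1; congr (_ + _).
  rewrite /al /be.
  have -> : (- a / sd) ^+ 2 + (a * r / sd + b) ^+ 2 + 2 * (- a / sd) * (a * r / sd + b) * r =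
     a ^+ 2 * (1 - r ^+ 2) / sd ^+ 2 + b ^+ 2 by field; rewrite gt_eqF.
  by rewrite sd2 mulfK// gt_eqF.
- exact: measurable_crossing_set.
have mS : measurable [set w | crossing_set rho u r (W w, (A t w, B t w))].
  have mWVZ : measurable_fun [set: Omega]
      ((fun w => (W w, (A t w, B t w))) : Omega -> (mR * (mR * mR))%type).
    exact: measurable_fun_triple.
  rewrite -[X in measurable X]setTI.
  by apply: mWVZ => //; exact: measurable_crossing_set.
apply: le_measure; rewrite ?inE// => w [h1 h2 h3].
have L0 := lag_ge0 (W w) (ltW u0) r01.
have AL : A t w <= u + lag r u (W w).
  have : sd * W w <= sd * Num.max (W w) 0 by rewrite ler_pM2l// le_max lexx.
  have -> : sd * W w = r * A t w - A s w by rewrite /W mulrC divfK// gt_eqF.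
  rewrite /lag -/sd => h4.
  rewrite -lerBlDl ler_pdivlMr//; lra.
split => //=.
set rho' := Num.sqrt (1 - rho ^+ 2) in h3 *.
have rho20 : 0 < 1 - rho ^+ 2 by nra.
have rho'0 : 0 < rho' by rewrite sqrtr_gt0.
have cE : Num.sqrt ((1 - rho) / (1 + rho)) * rho' = 1 - rho.
  by apply: rotation_slope; rewrite rho1.
rewrite -(@ltr_pM2r _ rho')// mulrBl mulrAC cE [X in _ - X]mulrAC divfK ?gt_eqF//.
rewrite [B t w * _]mulrC.
have : - (`|rho| * lag r u (W w)) <= - (rho * (A t w - u)).
  rewrite lerN2 (le_trans (ler_norm _))// normrM ler_wpM2l// ger0_norm; lra.
lra.
Qed.

(** The event is A(t) > u and B(t) >= c A(t), for independent standard normal A(t) and B(t). *)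
Lemma joint_exceedance_prob (rho u t : R) : -1 < rho < 1 -> 0 <= t <= T ->
  P [set w | (u < A t w)%R /\
     (A t w <= rho * A t w + Num.sqrt (1 - rho ^+ 2) * B t w)%R] =
  (joint_tail (Num.sqrt ((1 - rho) / (1 + rho))) u)%:E.
Proof.
rewrite /joint_tail.
move=> /andP[rho1 rho2] t0T.
set c := Num.sqrt ((1 - rho) / (1 + rho)); set rho' := Num.sqrt (1 - rho ^+ 2).
have rho20 : 0 < 1 - rho ^+ 2 by nra.
have rho'0 : 0 < rho' by rewrite sqrtr_gt0.
have cE : c * rho' = 1 - rho by apply: rotation_slope; rewrite rho1.
pose S : set (mR * mR) := [set x | u < x.1 /\ c * x.1 <= x.2].
have mS : measurable S.
  rewrite (_ : S = (fun x : mR * mR => u < x.1) @^-1` [set true] `&`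
     (fun x : mR * mR => c * x.1 <= x.2) @^-1` [set true]); last first.
    by apply/seteqP; split=> x [].
  have h (f : mR * mR -> bool) : measurable_fun setT f -> measurable (f @^-1` [set true]).
    by move=> mf; rewrite -[X in measurable X]setTI; exact: mf.
  apply: measurableI; apply: h.
    by apply: measurable_fun_ltr => //; exact: measurable_fst.
  apply: measurable_fun_ler; last exact: measurable_snd.
  by apply: measurable_funM => //; exact: measurable_fst.
have -> : [set w | u < A t w /\ A t w <= rho * A t w + rho' * B t w] =
    [set w | S (A t w, B t w)].
  apply/seteqP; split=> w /= [h1 h2]; split=> //=.
    rewrite -(@ler_pM2r _ rho')// mulrAC cE; lra.
  have : c * A t w * rho' <= B t w * rho' by rewrite ler_pM2r.
  by rewrite mulrAC cE; lra.
rewrite (@iid_normal2 _ _ _ P (A t) (B t))//; last first.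
  move=> b a th.
  rewrite (@eq_Rintegral _ _ _ _ _ (fun w => cos (0 * X t w + (b * p + a * p') * X t w +
    (0 * Y t w + (b * q + a * q') * Y t w) + th))); last first.
    by move=> w _; congr cos; rewrite /A /B; ring.
  rewrite (cos_joint _ _ _ _ _ gX cX vX gY cY vY XY iXY t0T t0T).
  congr (expR _ * _); congr (- _ / _); set r := acov _ _ _.
  have -> : 0 ^+ 2 + (b * p + a * p') ^+ 2 + 2 * 0 * (b * p + a * p') * r +
     (0 ^+ 2 + (b * q + a * q') ^+ 2 + 2 * 0 * (b * q + a * q') * r) =
     b ^+ 2 * (p ^+ 2 + q ^+ 2) +
     a ^+ 2 * (p' ^+ 2 + q' ^+ 2) + 2 * a * b * (p * p' + q * q') by ring.
  by rewrite pq1 pq1' pq0 mulr0 addr0 !mulr1.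
rewrite -[LHS]/(\int[gam]_v gam (xsection S v))%E.
pose f (v : R) := \1_(`]u, +oo[%classic : set R) v * std_normal_tail (c * v).
have c0 : 0 <= c by rewrite sqrtr_ge0.
have mf : measurable_fun [set: R] f.
  apply: measurable_funM; first exact: measurable_indic.
  apply: nonincreasing_measurable => // x y xy.
  by apply: std_normal_tail_nonincreasing; rewrite ler_wpM2l.
have -> : (\int[gam]_v gam (xsection S v) = \int[gam]_v (f v)%:E)%E.
  apply: eq_integral => v _; rewrite /f indicE.
  have [uv|uv] := boolP (v \in `]u, +oo[%classic).
    rewrite mul1r (_ : xsection S v = `[c * v, +oo[%classic); first exact: normal_prob_tail_cy.
    move: uv; rewrite inE/= in_itv/= andbT => uv.
    apply/seteqP; split=> z; rewrite /xsection/= inE /S/= in_itv/= andbT; first by case.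
    by split.
  rewrite mul0r (_ : xsection S v = set0) ?measure0//.
  apply/seteqP; split=> z //; rewrite /xsection/= inE /S/= => -[h _].
  by move: uv; rewrite mem_set//= in_itv/= h.
have fE (v : R) : f v * std_normal_pdf v =
    ((fun x => std_normal_pdf x * std_normal_tail (c * x)) \_ `]u, +oo[) v.
  rewrite patchE /f indicE; case: ifP => h; last by rewrite !mul0r.
  by rewrite mul1r mulrC.
have i1 : (@lebesgue_measure R).-integrable [set: R] (EFin \o (fun x => f x * std_normal_pdf x)).
  apply: (integrable_std_normal_sqr (C := 1) _ _).1 => // x.
  rewrite /f indicE mul1r ger0_norm; last by rewrite mulr_ge0 ?std_normal_tail_ge0.
  have := std_normal_tail_le1 (c * x); have := std_normal_tail_ge0 (c * x).
  by have := sqr_ge0 x; case: (_ \in _) => /=; lra.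
rewrite integral_std_normal// -[LHS]fineK; last exact: integrable_fin_num i1.
congr EFin.
rewrite -[LHS]/(\int[lebesgue_measure]_v (f v * std_normal_pdf v)).
under eq_Rintegral do rewrite fE.
rewrite -Rintegral_mkcond Rintegral_itv_obnd_cbnd//.
apply/integrable_mkcond => //.
apply: eq_integrable i1 => // x _ /=; rewrite fE.
by rewrite !patchE; case: ifP.
Qed.

End rotated_pair.

(** * Variance of the derivative of the paths *)

Section derivative_variance.
Context d {Omega : measurableType d} {R : realType} (P : probability Omega R).
Variables (T : R) (X : R -> {RV P >-> R}).
Hypothesis T0 : 0 < T.
Hypotheses (gX : gaussian_process T X) (cX : centered T X) (vX : unit_variance T X).
Hypothesis C1X : forall w, C1_path T (fun t => X t w).
Local Notation gam := (@normal_prob R 0 1).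

(** Dyadic meshes make the grids nested, and the events of exceedance on them increasing. *)
Definition mesh (m : nat) : R := T / 2 ^+ m.

Lemma mesh_gt0 m : 0 < mesh m.
Proof. by rewrite divr_gt0// exprn_gt0. Qed.

Lemma mesh_le m : mesh m <= T.
Proof. by rewrite ler_pdivrMr ?exprn_gt0// ler_pMr// exprn_ege1// ler1n. Qed.

Lemma cvg_mesh : mesh m @[m --> \oo] --> (0 : R).
Proof.
rewrite -[X in _ --> X](mulr0 T); apply: cvgMr.
under eq_fun do rewrite -exprVn.
by apply: cvg_expr; rewrite ger0_norm; lra.
Qed.

Let Z w := path_derivative T (fun t => X t w) 0.
Let Zm m w := (X (mesh m) w - X 0 w) / mesh m.
Let q m := 2 * (1 - acov X 0 (mesh m)) / mesh m ^+ 2.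

Let cvgZ w : Zm m w @[m --> \oo] --> Z w.
Proof.
have [/(_ 0) + _] := C1X w; rewrite lexx ltW// => /(_ isT) cv.
have {}cv : diff_quot_within T (fun t => X t w) 0 --> Z w by exact: cv.
have hm : mesh m @[m --> \oo] --> within `[0, T] (0 : R)^'.
  move=> U /= [e /= e0 He]; have /cvgrPdist_lt/(_ _ e0) hN := cvg_mesh.
  change (\forall m \near \oo, U (mesh m)); near=> m.
  have me : `|0 - mesh m| < e.
    by near: m; exact: hN.
  apply: He => //=; first by rewrite gt_eqF// mesh_gt0.
  by rewrite in_itv/= ltW ?mesh_gt0// mesh_le.
have := @cvg_comp _ _ _ (fun m => mesh m) (fun s => (X s w - X 0 w) / (s - 0)) _ _ _ hm cv.
rewrite /Zm; have -> : (fun m => (X (mesh m) w - X 0 w) / mesh m) =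
  (fun s => (X s w - X 0 w) / (s - 0)) \o (fun m => mesh m).
  by apply/funext => m /=; rewrite subr0.
by [].
Unshelve. all: end_near. Qed.

Let mZm m : measurable_fun [set: Omega] (Zm m).
Proof. by apply: measurable_funM => //; exact: measurable_funB. Qed.

Let mZ : measurable_fun [set: Omega] Z.
Proof. by apply: (measurable_fun_cvg mZm) => w _; exact: cvgZ. Qed.

Let i0T : 0 <= (0 : R) <= T. Proof. by rewrite lexx ltW. Qed.
Let imT m : 0 <= mesh m <= T. Proof. by rewrite ltW ?mesh_gt0// mesh_le. Qed.

Let q_ge0 m : 0 <= q m.
Proof.
have /andP[_ r1] := acov_itv gX cX vX i0T (imT m).
by rewrite divr_ge0 ?sqr_ge0// mulr_ge0// subr_ge0.
Qed.

Let cosZm m (th b : R) : \int[P]_w cos (th * Zm m w + b) =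
  expR (- (th ^+ 2 * q m) / 2) * cos b.
Proof.
have h0 : mesh m != 0 by rewrite gt_eqF// mesh_gt0.
rewrite (@eq_Rintegral _ _ _ _ _ (fun w => cos (- th / mesh m * X 0 w + th / mesh m * X (mesh m) w + b))).
  rewrite (cos_comb gX cX vX)//.
  have -> : (- th / mesh m) ^+ 2 + (th / mesh m) ^+ 2 +
      2 * (- th / mesh m) * (th / mesh m) * acov X 0 (mesh m) = th ^+ 2 * q m.
    by rewrite /q; move: (acov _ _ _) => r; field.
  by [].
by move=> w _; congr cos; rewrite /Zm; field.
Qed.

Let mcos (f : Omega -> R) (th b : R) : measurable_fun [set: Omega] f ->
  measurable_fun [set: Omega] (fun w => cos (th * f w + b)).
Proof.
move=> mf; apply: (measurableT_comp (@measurable_cos R)).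
by apply: measurable_funD => //; exact: measurable_funM.
Qed.

Let cvg_cosZm (th b : R) :
  expR (- (th ^+ 2 * q m) / 2) * cos b @[m --> \oo] --> \int[P]_w cos (th * Z w + b).
Proof.
under eq_fun do rewrite -cosZm.
apply: (@cvg_Rintegral_dominated _ _ _ P _ _ (cst 1)).
- by move=> m; exact: mcos.
- move=> w; apply: (@cvg_comp _ _ _ (fun m => th * Zm m w + b) cos); last exact: continuous_cos.
  by apply: cvgD; [apply: cvgM; [exact: cvg_cst|exact: cvgZ]|exact: cvg_cst].
- by move=> m w; exact: cos_max.
- exact: finite_measure_integrable_cst.
Qed.

(** The characteristic function of Z tends to 1 at 0, so at some point it is positive and has a
logarithm. *)
Let cos_pos : exists2 th : R, 0 < th & 0 < \int[P]_w cos (th * Z w + 0).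
Proof.
have cv : (\int[P]_w cos (n.+1%:R^-1 * Z w + 0)) @[n --> \oo] --> (1 : R).
  have e1 : \int[P]_w (cst 1 w) = 1.
    by rewrite Rintegral_cst// -[fine _]/(fine (P setT)) probability_setT mulr1.
  rewrite -[X in _ --> X]e1.
  apply: (@cvg_Rintegral_dominated _ _ _ P _ _ (cst 1)).
  - by move=> m; exact: mcos.
  - move=> w; rewrite /cst -[X in _ --> X](@cos0 R).
    apply: (@cvg_comp _ _ _ (fun n => n.+1%:R^-1 * Z w + 0) cos); last exact: continuous_cos.
    have : n.+1%:R^-1 * Z w + 0 @[n --> \oo] --> 0 * Z w + 0.
      apply: cvgD; last exact: cvg_cst.
      by apply: cvgM; [exact: cvg_harmonic|exact: cvg_cst].
    by rewrite mul0r addr0.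
  - by move=> m w; exact: cos_max.
  - exact: finite_measure_integrable_cst.
have [N _ /(_ N (leqnn N)) h] := cvgr_gt _ cv _ ltr01.
by exists N.+1%:R^-1 => //; rewrite invr_gt0.
Qed.

(** The difference quotients converge pointwise to Z, so their characteristic functions
exp (- th^2 q_m / 2) converge to that of Z. At a th where the limit is positive this forces
q_m to converge, to sg2 say, and then Z is N(0, sg2). When sg2 = 0 the bound
by Var Z is the positivity of a variance; otherwise it is an equality. *)
Lemma increment_variance_cvg : exists2 sg2, 0 <= sg2 <= fine 'V_P[Z]%E &
  2 * (1 - acov X 0 (mesh m)) / mesh m ^+ 2 @[m --> \oo] --> sg2.
Proof.
rewrite -/q.
have [th th0 L0] := cos_pos.
set L := \int[P]_w cos (th * Z w + 0) in L0.
have cL : expR (- (th ^+ 2 * q m) / 2) @[m --> \oo] --> L.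
  have := @cvg_cosZm th 0; rewrite cos0.
  by under eq_fun do rewrite mulr1.
(* The solution of L = exp (- th^2 sg2 / 2). *)
pose sg2 := (- 2 / th ^+ 2) * ln L.
have cq : q m @[m --> \oo] --> sg2.
  have -> : q = (fun m => (- 2 / th ^+ 2) * ln (expR (- (th ^+ 2 * q m) / 2))).
    by apply/funext => m; rewrite expRK; field; rewrite gt_eqF.
  apply: cvgMr; apply: (cvg_comp _ _ cL).
  exact: continuous_ln.
have sg0 : 0 <= sg2.
  rewrite -(cvg_lim _ cq)//; apply: limr_ge; first by apply/cvg_ex; eexists; exact: cq.
  by apply: nearW => m; exact: q_ge0.
exists sg2 => //; rewrite sg0/=.
have V0 : 0 <= fine 'V_P[Z]%E by rewrite fine_ge0// variance_ge0.
have [->//|sgn0] := eqVneq sg2 0.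
have sgp : 0 < sg2 by rewrite lt_neqAle eq_sym sgn0.
have cosZ (a b : R) : \int[P]_w cos (a * Z w + b) = expR (- (a ^+ 2 * sg2) / 2) * cos b.
  have := @cvg_cosZm a b; move/cvg_unique; apply => //.
  apply: cvgM; last exact: cvg_cst.
  apply: (@cvg_comp _ _ _ (fun m => - (a ^+ 2 * q m) / 2) expR); last exact: continuous_expR.
  apply: cvgM; last exact: cvg_cst.
  by apply: cvgN; apply: cvgM => //; exact: cvg_cst.
set sg := Num.sqrt sg2.
have sgg0 : 0 < sg by rewrite sqrtr_gt0.
have sgE : sg ^+ 2 = sg2 by rewrite sqr_sqrtr.
pose U w := Z w / sg.
have mU : measurable_fun [set: Omega] U by exact: measurable_funM.
have ZU w : Z w = sg * U w by rewrite /U mulrC divfK// gt_eqF.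
have law (B : set R) : measurable B -> P (U @^-1` B) = gam (id @^-1` B).
  move=> mB.
  have := @normal_weighted_law _ _ _ P (cst 1) U 1 1.
  move=> /(_ _ _ mU _ B mB); rewrite !mul1r => cwl.
  have {cwl} : \int[P]_w (1 * \1_B (U w)) = fine (gam B).
    apply: cwl => //; first by move=> w; rewrite normr1.
    move=> a b; under eq_Rintegral do rewrite mul1r.
    rewrite (@eq_Rintegral _ _ _ _ _ (fun w => cos (a / sg * Z w + b))); last first.
      by move=> w _; congr cos; rewrite /U; ring.
    rewrite cosZ mul1r.
    have -> : (a / sg) ^+ 2 * sg2 = a ^+ 2 by rewrite -sgE; field; rewrite gt_eqF.
    by [].
  under eq_Rintegral do rewrite mul1r.
  have mUB : measurable (U @^-1` B) by rewrite -[X in measurable X]setTI; exact: mU.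
  rewrite -[LHS]/(\int[P]_w (\1_(U @^-1` B) w)).
  rewrite /Rintegral integral_indic// setIT => e.
  by rewrite -[LHS]fineK ?fin_num_measure// e fineK// fin_num_measure.
have EZ : ('E_P[Z] = 0)%E.
  rewrite unlock.
  have := integral_same_law mU (@measurable_id _ (measurableTypeR R) setT) law
    (f := fun x => sg * x).
  under eq_integral do rewrite -ZU.
  move=> ->; last exact: measurable_funM.
  have iid := @integrable_std_normal_id R.
  under eq_integral do rewrite EFinM.
  rewrite integralZl// -[X in (_ * X)%E]fineK; last exact: integrable_fin_num iid.
  by rewrite -[fine _]/(\int[gam]_x x) mean_std_normal mule0.
have VZ : ('V_P[Z] = sg2%:E)%E.
  rewrite /variance unlock EZ/= unlock.
  have := integral_same_law mU (@measurable_id _ (measurableTypeR R) setT) law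
    (f := fun x => sg2 * x ^+ 2).
  rewrite (@eq_integral _ _ _ P setT (fun w => (((Z \- cst 0) * (Z \- cst 0)) w)%:E)); last first.
    move=> w _; rewrite -[RHS]/(((Z w - 0) * (Z w - 0))%:E) !subr0 ZU -sgE.
    by congr EFin; ring.
  move=> ->; last by apply: measurable_funM => //; exact: measurable_funX.
  have iid := @integrable_std_normal_expr2 R.
  under eq_integral do rewrite EFinM.
  rewrite integralZl// -[X in (_ * X)%E]fineK; last exact: integrable_fin_num iid.
  by rewrite -[fine _]/(\int[gam]_x (x ^+ 2)) second_moment_std_normal mule1.
by rewrite VZ.
Qed.

End derivative_variance.

(** * Maxima of continuous paths over dyadic grids *)

Section path_maxima.
Context {R : realType}.
Variable T : R.
Hypothesis T0 : 0 < T.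
Implicit Types f g : R -> R.

(** A converging difference quotient is bounded near t, which is a local Lipschitz bound at t. *)
Lemma C1_path_continuous f : C1_path T f -> {within `[0, T], continuous f}.
Proof.
move=> [df _]; apply/subspace_continuousP => t; rewrite /= in_itv/= => tT.
have cq := df t tT.
set l := lim (diff_quot_within T f t).
have /cvgrPdist_lt/(_ 1 ltr01) hl : diff_quot_within T f t --> l by exact: cq.
apply/cvgrPdist_lt => e e0.
have K0 : 0 < `|l| + 1 by rewrite ltr_wpDl.
have d0 : 0 < e / (`|l| + 1) by rewrite divr_gt0.
have ht : \forall s \near t, `|t - s| < e / (`|l| + 1).
  by exists (e / (`|l| + 1)).
change (\forall s \near t, `[0, T]%classic s -> `|f t - f s| < e).
have {}hl : \forall s \near t, s != t -> `[0, T]%classic s ->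
    `|l - (f s - f t) / (s - t)| < 1 by exact: hl.
apply: filterS2 hl ht => s hs hts sT.
have [->|st] := eqVneq s t; first by rewrite subrr normr0.
have {}hs := hs st sT.
have q1 : `|(f s - f t) / (s - t)| < `|l| + 1.
  have := ler_normB ((f s - f t) / (s - t) - l) (- l).
  by rewrite opprK subrK distrC normrN => h; apply: (le_lt_trans h); rewrite addrC ltrD2l.
rewrite distrC -[f s - f t](@divfK _ (s - t)) ?subr_eq0// normrM.
rewrite distrC in hts.
apply: (@le_lt_trans _ _ ((`|l| + 1) * `|s - t|)).
  by rewrite ler_wpM2r// ltW.
by rewrite mulrC -ltr_pdivlMr.
Qed.

Lemma within_continuous_min f g : {within `[0, T], continuous f} ->
  {within `[0, T], continuous g} ->
  {within `[0, T], continuous (fun t => Num.min (f t) (g t))}.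
Proof.
move=> /subspace_continuousP cf /subspace_continuousP cg.
have -> : (fun t => Num.min (f t) (g t)) = (fun t => (f t + g t - `|f t - g t|) / 2).
  by apply/funext => t; exact: minr_absE.
apply/subspace_continuousP => t tT.
apply: cvgM; last exact: cvg_cst.
have cft := cf t tT; have cgt := cg t tT.
by apply: cvgB; [exact: cvgD|apply: cvg_norm; exact: cvgB].
Qed.

Lemma path_max_ge g t : {within `[0, T], continuous g} -> 0 <= t <= T ->
  g t <= path_max T g.
Proof.
move=> cg tT; have [c _ gc] := EVT_max (ltW T0) cg.
apply: ub_le_sup; last by exists t.
by exists (g c) => _ [s sT <-]; exact: gc.
Qed.

Lemma grid_itv m k : (k <= 2 ^ m)%N -> 0 <= k%:R * mesh T m <= T.
Proof.
move=> km; rewrite mulr_ge0 ?(ltW (mesh_gt0 T0 m))//=.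
rewrite /mesh mulrCA ler_piMr ?(ltW T0)// ler_pdivrMr ?exprn_gt0// mul1r.
by rewrite -natrX ler_nat.
Qed.

Lemma path_max_gt_grid g v : {within `[0, T], continuous g} -> v < path_max T g ->
  exists m, exists2 k, (k <= 2 ^ m)%N & v < g (k%:R * mesh T m).
Proof.
move=> /subspace_continuousP cg vg.
have [] := sup_gt _ vg; first by exists (g 0), 0 => //=; rewrite in_itv/= lexx ltW.
move=> _ [t tT <-] vt.
have := cvgr_gt _ (cg t tT) _ vt => -[e /= e0 He].
have /cvgrPdist_lt/(_ _ e0) [m _ /(_ m (leqnn m))] := cvg_mesh T.
rewrite sub0r normrN => /(le_lt_trans (ler_norm _)) me.
move: (tT); rewrite /= in_itv/= => /andP[t0 t1].
have m0 := mesh_gt0 T0 m.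
have tm0 : 0 <= t / mesh T m by rewrite divr_ge0// ltW.
set k := Num.trunc (t / mesh T m).
have /andP[k1 k2] := truncn_itv tm0.
have km : (k <= 2 ^ m)%N.
  rewrite -(ler_nat R) (le_trans k1)// ler_pdivrMr//.
  by rewrite natrX /mesh mulrC divfK// expf_neq0.
exists m, k => //.
rewrite ler_pdivlMr// in k1; rewrite ltr_pdivrMr// -natr1 mulrDl mul1r in k2.
apply: He => /=; last by have := grid_itv km; rewrite in_itv.
rewrite ger0_norm ?subr_ge0//; apply: le_lt_trans me.
by rewrite lerBlDl ltW.
Qed.

(** Expresses an event on the supremum by countably many times, hence as a measurable set. *)
Lemma path_max_le_grid g u : {within `[0, T], continuous g} ->
  u <= path_max T g <-> forall n, exists m, exists2 k, (k <= 2 ^ m)%N &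
    u - n.+1%:R^-1 < g (k%:R * mesh T m).
Proof.
move=> cg; split=> [ug n|H].
  by apply: path_max_gt_grid => //; rewrite ltrBlDr (le_lt_trans ug)// ltrDl.
rewrite leNgt; apply/negP => gu.
have e0 : 0 < u - path_max T g by rewrite subr_gt0.
have /cvgrPdist_lt/(_ _ e0)[n _ /(_ n (leqnn n))] := @cvg_harmonic R.
rewrite sub0r normrN => /(le_lt_trans (ler_norm _)) /= ne.
have [m [k km gt]] := H n.
have := lt_le_trans gt (path_max_ge cg (grid_itv km)).
by rewrite ltrBlDl -ltrBlDr ltNge (ltW ne).
Qed.

End path_maxima.

(** * Limits of the bounds *)

Section bound_limits.
Context {R : realType}.
Local Notation leb := (@lebesgue_measure R).
Local Notation phi := (@std_normal_pdf R).

(** The integrand is at most 1. *)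
Lemma joint_tailB_le (c v u : R) : 0 <= c -> v <= u ->
  joint_tail c v <= joint_tail c u + (u - v).
Proof.
move=> c0 vu.
pose f x := phi x * std_normal_tail (c * x).
have f0 x : 0 <= f x by rewrite mulr_ge0 ?std_normal_pdf_ge0// std_normal_tail_ge0.
have f1 x : f x <= phi x by rewrite ler_piMr ?std_normal_pdf_ge0// std_normal_tail_le1.
have mf : measurable_fun [set: R] f.
  apply: measurable_funM; first exact: measurable_std_normal_pdf.
  apply: nonincreasing_measurable => // x y xy.
  by apply: std_normal_tail_nonincreasing; rewrite ler_wpM2l.
have fi : leb.-integrable [set: R] (EFin \o f).
  apply: (@integrable_dominated _ (measurableTypeR R) R leb _ phi) => //.
    by move=> x; rewrite ger0_norm.
  exact: integrable_normal_pdf.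
have itvE : `[v, +oo[%classic = `[v, u[%classic `|` `[u, +oo[%classic.
  apply/seteqP; split=> y /=; rewrite !in_itv/= !andbT.
    by move=> h; case: (leP u y) => uy; [right|left; rewrite h].
  by move=> [/andP[]//|uy]; exact: le_trans uy.
rewrite /joint_tail itvE Rintegral_setU//=; last 2 first.
- by apply: integrableS fi => //; rewrite -itvE.
- rewrite disj_set2E; apply/eqP/seteqP; split=> y //=; rewrite !in_itv/= andbT.
  by move=> [/andP[_ h] h']; have := lt_le_trans h h'; rewrite ltxx.
rewrite addrC lerD2l.
apply: (@le_trans _ _ (\int[leb]_(x in `[v, u[) (cst 1 x))).
  have m1 : leb.-integrable `[v, u[%classic (EFin \o cst (1 : R)).
    apply/integrableP; split; first by apply/measurable_EFinP; exact: measurable_cst.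
    rewrite (eq_integral (cst 1%E)); last by move=> x _ /=; rewrite normr1.
    rewrite integral_cst//= lebesgue_measure_itv/= mul1e.
    by case: ifP => _; rewrite ltry.
  apply: le_Rintegral => //; first by apply: integrableS fi.
  by move=> x _; rewrite (le_trans (f1 x))// std_normal_pdf_le1.
rewrite Rintegral_cst//= lebesgue_measure_itv/= lte_fin mul1r.
by case: ltgtP vu => // -> _; rewrite subrr.
Qed.

(** Put q_m = 2 (1 - r_m) / h^2 with h = T / 2^m. Then 2^m (1 - r_m) = T q_m h / 2 vanishes in the
limit, while 2^m sqrt (1 - r_m^2) is sqrt (T^2 q_m (1 + r_m) / 2), with limit
T sqrt (sg2). *)
Lemma cvg_crossing_bound (T rho u sg2 : R) (r : nat -> R) :
  0 < T -> (forall m, -1 <= r m <= 1) ->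
  2 * (1 - r m) / mesh T m ^+ 2 @[m --> \oo] --> sg2 ->
  r m @[m --> \oo] --> (1 : R) /\
  2 ^+ m * crossing_bound rho u (r m) @[m --> \oo] -->
    phi u * (std_normal_tail (Num.sqrt ((1 - rho) / (1 + rho)) * u) *
      (T * Num.sqrt sg2 / Num.sqrt (2 * pi))).
Proof.
move=> T0 r1 cq.
set k := `|rho| / Num.sqrt (1 - rho ^+ 2).
set tl := std_normal_tail _; set S := Num.sqrt (2 * pi).
pose q m := 2 * (1 - r m) / mesh T m ^+ 2.
have {}cq : q m @[m --> \oo] --> sg2 by exact: cq.
have h0 m : mesh T m != 0 by rewrite gt_eqF// mesh_gt0.
have ch := @cvg_mesh _ T.
pose a m := T * q m * mesh T m / 2.
have ca : a m @[m --> \oo] --> (0 : R).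
  rewrite -[X in _ --> X](_ : T * sg2 * 0 / 2 = 0); last by rewrite mulr0 mul0r.
  apply: cvgM; last exact: cvg_cst.
  by apply: cvgM => //; apply: cvgM => //; exact: cvg_cst.
have aE m : 2 ^+ m * (1 - r m) = a m.
  have -> : 2 ^+ m = T / mesh T m by rewrite /mesh invf_div mulrCA divff ?mulr1// gt_eqF.
  by rewrite /a /q; field; rewrite h0.
have cr : r m @[m --> \oo] --> (1 : R).
  have -> : r = (fun m => 1 - q m * mesh T m ^+ 2 / 2).
    by apply/funext => m; rewrite /q divfK ?expf_neq0//; field.
  rewrite -[X in _ --> X](_ : 1 - sg2 * 0 ^+ 2 / 2 = 1); last by rewrite expr0n mulr0 mul0r subr0.
  apply: cvgB; first exact: cvg_cst.
  apply: cvgM; last exact: cvg_cst.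
  by apply: cvgM => //; exact: cvgM.
split=> //.
pose b m := Num.sqrt (T ^+ 2 * q m * (1 + r m) / 2).
have cb : b m @[m --> \oo] --> T * Num.sqrt sg2.
  have -> : T * Num.sqrt sg2 = Num.sqrt (T ^+ 2 * sg2 * (1 + 1) / 2).
    rewrite -mulrA divff// mulr1 sqrtrM ?sqr_ge0//.
    by rewrite sqrtr_sqr gtr0_norm.
  apply: (@cvg_comp _ _ _ (fun m => T ^+ 2 * q m * (1 + r m) / 2) Num.sqrt); last exact: sqrt_continuous.
  apply: cvgM; last exact: cvg_cst.
  apply: cvgM; last by apply: cvgD => //; exact: cvg_cst.
  by apply: cvgM => //; exact: cvg_cst.
have bE m : 2 ^+ m * Num.sqrt (1 - r m ^+ 2) = b m.
  have p2 : 0 <= 2 ^+ m :> R by rewrite exprn_ge0.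
  rewrite -[X in X * _](ger0_norm p2) -sqrtr_sqr -sqrtrM ?sqr_ge0//; congr Num.sqrt.
  rewrite (_ : 1 - r m ^+ 2 = (1 - r m) * (1 + r m)); last by ring.
  have -> : 2 ^+ m = T / mesh T m by rewrite /mesh invf_div mulrCA divff ?mulr1// gt_eqF.
  by rewrite /q; field; rewrite h0.
have -> : (fun m => 2 ^+ m * crossing_bound rho u (r m)) = (fun m =>
    phi u * (tl * ((a m * u + b m / S) / r m) +
      k * (2 * (a m * (1 - r m) * u ^+ 2 + a m * (1 + r m)) / r m ^+ 2))).
  apply/funext => m; rewrite /crossing_bound -/k -/tl -/S -aE -bE.
  by ring.
have c1r : 1 - r m @[m --> \oo] --> (1 - 1 : R) by apply: cvgB => //; exact: cvg_cst.
have c1r' : 1 + r m @[m --> \oo] --> (1 + 1 : R) by apply: cvgD => //; exact: cvg_cst.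
rewrite -[X in _ --> X](_ : phi u * (tl * ((0 * u + T * Num.sqrt sg2 / S) / 1) +
      k * (2 * (0 * (1 - 1) * u ^+ 2 + 0 * (1 + 1)) / 1 ^+ 2)) = _); last first.
  by rewrite !mul0r !addr0 mulr0 mul0r mulr0 addr0 add0r divr1.
apply: cvgMr; apply: cvgD; apply: cvgMr.
- apply: cvgM; last by apply: cvgV => //; exact: oner_neq0.
  by apply: cvgD; [exact: cvgMl|exact: cvgMl].
- apply: cvgM; last by apply: cvgV; [rewrite expr1n oner_neq0|exact: cvgM].
  apply: cvgMr; apply: cvgD; last exact: cvgM.
  by apply: cvgMl; exact: cvgM.
Qed.

End bound_limits.

(** * The exceedance probability *)

Section joint_exceedances.
Context d {Omega : measurableType d} {R : realType} (P : probability Omega R).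
Variables (T rho : R) (X Y : R -> {RV P >-> R}).
Hypotheses (T0 : 0 < T) (rho_itv : -1 < rho < 1).
Hypotheses (HX : std_C1_stationary_gaussian T X) (HY : std_C1_stationary_gaussian T Y).
Hypotheses (XY : same_fdd T X Y) (iXY : independent_processes T X Y).
Local Notation rho' := (Num.sqrt (1 - rho ^+ 2)).
Local Notation c := (Num.sqrt ((1 - rho) / (1 + rho))).

Let X2 t w := rho * X t w + rho' * Y t w.
Let M t w := Num.min (X t w) (X2 t w).

Let mX2 t : measurable_fun [set: Omega] (X2 t).
Proof. by apply: measurable_funD; exact: measurable_funM. Qed.

Let mM t : measurable_fun [set: Omega] (M t).
Proof. exact: measurable_minr. Qed.

Let sqr_rho' : rho' ^+ 2 = 1 - rho ^+ 2.
Proof. by rewrite sqr_sqrtr//; case/andP: rho_itv => r1 r2; nra. Qed.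

Let gX : gaussian_process T X. Proof. by case: HX. Qed.
Let sX : stationary T X. Proof. by case: HX. Qed.
Let cX : centered T X. Proof. by case: HX. Qed.
Let vX : unit_variance T X. Proof. by case: HX. Qed.
Let gY : gaussian_process T Y. Proof. by case: HY. Qed.
Let cY : centered T Y. Proof. by case: HY. Qed.
Let vY : unit_variance T Y. Proof. by case: HY. Qed.

(** The matrix of this rotation is an involution. *)
Let X_rotated t w : rho * X2 t w + rho' * (rho' * X t w + - rho * Y t w) = X t w.
Proof.
have -> : rho * X2 t w + rho' * (rho' * X t w + - rho * Y t w) =
  (rho ^+ 2 + rho' ^+ 2) * X t w by rewrite /X2; ring.
by rewrite sqr_rho' subrKC mul1r.
Qed.

Let upcrossing1_prob v s t : 0 < v -> 0 <= s <= T -> 0 <= t <= T -> 0 < acov X s t ->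
  (P ([set w | (X s w <= v)%R] `&` [set w | (v < M t w)%R])
    <= (crossing_bound rho v (acov X s t))%:E)%E.
Proof.
move=> v0 s0T t0T r0.
have := @crossing_prob _ _ _ P T X Y gX cX vX gY cY vY XY iXY 1 0 0 1
  _ _ _ rho v s t rho_itv v0 s0T t0T r0.
rewrite expr1n expr0n addr0 add0r mulr0 mul0r addr0 => /(_ erefl erefl erefl).
apply: le_trans; rewrite le_eqVlt; apply/orP; left; apply/eqP; congr (P _).
apply/seteqP; split=> w /=; rewrite !mul1r !mul0r !addr0 !add0r lt_min.
  by move=> [h1 /andP[]].
by move=> [h1 h2 h3]; split => //; apply/andP.
Qed.

Let upcrossing2_prob v s t : 0 < v -> 0 <= s <= T -> 0 <= t <= T -> 0 < acov X s t ->
  (P ([set w | (X2 s w <= v)%R] `&` [set w | (v < M t w)%R])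
    <= (crossing_bound rho v (acov X s t))%:E)%E.
Proof.
move=> v0 s0T t0T r0.
have := @crossing_prob _ _ _ P T X Y gX cX vX gY cY vY XY iXY rho rho' rho' (- rho)
  _ _ _ rho v s t rho_itv v0 s0T t0T r0.
rewrite sqrrN sqr_rho' subrKC subrK.
rewrite mulrN [rho' * rho]mulrC subrr => /(_ erefl erefl erefl).
apply: le_trans; rewrite le_eqVlt; apply/orP; left; apply/eqP; congr (P _).
apply/seteqP; split=> w /=; rewrite (X_rotated t w) lt_min.
  by move=> [h1 /andP[]].
by move=> [h1 h2 h3]; split => //; apply/andP.
Qed.

Let start_prob v t : 0 <= t <= T ->
  (P [set w | (v < M t w)%R] <= (2 * joint_tail c v)%:E)%E.
Proof.
move=> t0T.
have := @joint_exceedance_prob _ _ _ P T X Y gX cX vX gY cY vY XY iXY 1 0 0 1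
  _ _ _ rho v t rho_itv t0T.
rewrite expr1n expr0n addr0 add0r mulr0 mul0r addr0 => /(_ erefl erefl erefl).
set E1 := [set w | _] => e1.
have := @joint_exceedance_prob _ _ _ P T X Y gX cX vX gY cY vY XY iXY rho rho' rho' (- rho)
  _ _ _ rho v t rho_itv t0T.
rewrite sqrrN sqr_rho' subrKC subrK.
rewrite mulrN [rho' * rho]mulrC subrr => /(_ erefl erefl erefl).
set E2 := [set w | _] => e2.
have E1E : E1 = [set w | v < X t w] `&` [set w | X t w <= X2 t w].
  by apply/seteqP; split=> w; rewrite /E1/= !mul1r !mul0r !addr0 !add0r.
have E2E : E2 = [set w | v < X2 t w] `&` [set w | X2 t w <= X t w].
  by apply/seteqP; split=> w; rewrite /E2/= (X_rotated t w).
have mE1 : measurable E1.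
  by rewrite E1E; apply: measurableI; [exact: measurable_lt_set|exact: measurable_le_set].
have mE2 : measurable E2.
  by rewrite E2E; apply: measurableI; [exact: measurable_lt_set|exact: measurable_le_set].
apply: (@le_trans _ _ (P (E1 `|` E2))).
  apply: le_measure; rewrite ?inE; [exact: measurable_lt_set|exact: measurableU|].
  move=> w /=; rewrite lt_min => /andP[h1 h2]; rewrite E1E E2E.
  by have [h|/ltW h] := leP (X t w) (X2 t w); [left|right]; split.
rewrite (le_trans (measureU2 _ _ _))//.
rewrite mulr_natl mulr2n EFinD.
by apply: leeD; rewrite le_eqVlt; apply/orP; left; apply/eqP; [exact: e1|exact: e2].
Qed.

(** Only the first n steps are considered, to allow an induction on n. *)
Let exceed (m : nat) (v : R) (n : nat) : set Omega :=
  [set w | exists2 k, (k <= n)%N & v < M (k%:R * mesh T m) w].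

Let measurable_exceed m v n : measurable (exceed m v n).
Proof.
rewrite (_ : exceed m v n = \bigcup_(k in [set k | (k <= n)%N])
    [set w | v < M (k%:R * mesh T m) w]); last first.
  by apply/seteqP; split=> w [k kn vk]; exists k.
by apply: bigcup_measurable => k _; exact: measurable_lt_set.
Qed.

(** Each further step adds the probability of an upcrossing by one of the two components;
by stationarity all the steps have the same bound. *)
Let exceed_prob m v n : 0 < v -> 0 < acov X 0 (mesh T m) -> (n <= 2 ^ m)%N ->
  (P (exceed m v n) <=
    (2 * joint_tail c v + 2 * (n%:R * crossing_bound rho v (acov X 0 (mesh T m))))%:E)%E.
Proof.
move=> v0 r0; elim: n => [_|n IH nm].
  rewrite mul0r mulr0 addr0; apply: le_trans (start_prob v (t := 0) _); last by rewrite lexx ltW.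
  apply: le_measure; rewrite ?inE; [exact: measurable_exceed|exact: measurable_lt_set|].
  by move=> w [k]; rewrite leqn0 => /eqP ->; rewrite mul0r.
have tn := grid_itv T0 (ltnW nm); have tn1 := grid_itv T0 nm.
set s := n%:R * mesh T m in tn; set t := n.+1%:R * mesh T m in tn1.
have tE : t = s + mesh T m by rewrite /t -natr1 mulrDl mul1r.
have rE : acov X s t = acov X 0 (mesh T m).
  rewrite tE (acov_stationary gX cX vX sX)//.
  - by rewrite ltW// mesh_gt0.
  - by case/andP: tn.
  - by rewrite -tE; case/andP: tn1.
rewrite -rE in r0 IH *.
have mI (U : R -> Omega -> R) : (forall t, measurable_fun [set: Omega] (U t)) ->
    measurable ([set w | U s w <= v] `&` [set w | v < M t w]).
  by move=> mU; apply: measurableI; [exact: measurable_le_set|exact: measurable_lt_set].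
have mX t' : measurable_fun [set: Omega] (X t') by [].
apply: (@le_trans _ _ (P (exceed m v n `|`
   (([set w | X s w <= v] `&` [set w | v < M t w]) `|`
    ([set w | X2 s w <= v] `&` [set w | v < M t w]))))).
  apply: le_measure; rewrite ?inE.
  - exact: measurable_exceed.
  - apply: measurableU; first exact: measurable_exceed.
    by apply: measurableU; [exact: (mI (fun t => X t))|exact: (mI X2)].
  - move=> w [k]; rewrite leq_eqVlt ltnS => /orP[/eqP ->|kn vk]; last by left; exists k.
    rewrite -/t => vt.
    have [vs|] := ltP v (M s w); first by left; exists n.
    by rewrite ge_min => /orP[h|h]; right; [left|right].
apply: (le_trans (measureU2 _ _ _)); first exact: measurable_exceed.
  by apply: measurableU; [exact: (mI (fun t => X t))|exact: (mI X2)].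
set b := crossing_bound _ _ _.
have -> : 2 * joint_tail c v + 2 * (n.+1%:R * b) = 2 * joint_tail c v + 2 * (n%:R * b) + 2 * b.
  by rewrite -[n.+1%:R]natr1; ring.
rewrite EFinD leeD//; first by apply: IH; exact: ltnW.
apply: (le_trans (measureU2 _ _ _)); [exact: (mI (fun t => X t))|exact: (mI X2)|].
rewrite mulr_natl mulr2n EFinD leeD//.
  exact: upcrossing1_prob.
exact: upcrossing2_prob.
Qed.

Let exceed_mono v : {homo (fun m => exceed m v (2 ^ m)) : m n / (m <= n)%N >-> (m <= n)%O}.
Proof.
apply/nondecreasing_seqP => m; apply/subsetPset => w [k km vk].
exists (k * 2)%N; first by rewrite expnS mulnC leq_mul2l.
rewrite (_ : (k * 2)%:R * mesh T m.+1 = k%:R * mesh T m)//.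
by rewrite natrM /mesh exprS; field; rewrite expf_neq0.
Qed.

Let within_continuous_M w : {within `[0, T], continuous (fun t => M t w)}.
Proof.
have cx : {within `[0, T], continuous (fun t => X t w)}.
  by apply: C1_path_continuous; case: HX.
have cy : {within `[0, T], continuous (fun t => Y t w)}.
  by apply: C1_path_continuous; case: HY.
apply: within_continuous_min => //.
move/subspace_continuousP: cx => cx; move/subspace_continuousP: cy => cy.
apply/subspace_continuousP => t tT.
by apply: cvgD; apply: cvgMr; [exact: cx|exact: cy].
Qed.

Lemma measurable_path_max_ge u :
  measurable [set w | u <= path_max T (fun t => M t w)].
Proof.
rewrite (_ : [set w | _] = \bigcap_n \bigcup_m exceed m (u - n.+1%:R^-1) (2 ^ m)).
  apply: bigcap_measurable => [|n _]; first by exists 0.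
  by apply: bigcup_measurable => m _; exact: measurable_exceed.
apply/seteqP; split=> w /=.
  move/(path_max_le_grid T0 _ (@within_continuous_M w)) => h n _.
  by have [m [k km gt]] := h n; exists m => //; exists k.
move=> h; apply/(path_max_le_grid T0 _ (@within_continuous_M w)) => n.
by have [m _ [k km gt]] := h n I; exists m, k.
Qed.

Let Z w := path_derivative T (fun t => X t w) 0.

Definition joint_bound (v : R) : R := 2 * joint_tail c v +
  2 * T * std_normal_pdf v * (Num.sqrt (fine 'V_P[Z]%E) / Num.sqrt (2 * pi)) *
  std_normal_tail (c * v).

Lemma grid_exceedance_prob v : 0 < v ->
  (P (\bigcup_m exceed m v (2 ^ m)) <= (joint_bound v)%:E)%E.
Proof.
move=> v0.
have CX : forall w, C1_path T (fun t => X t w) by case: HX.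
have [sg2 /andP[sg0 sgV] cq] := increment_variance_cvg T0 gX cX vX CX.
have i0T : 0 <= (0 : R) <= T by rewrite lexx ltW.
have r01 m : -1 <= acov X 0 (mesh T m) <= 1.
  by apply: (acov_itv gX cX vX) => //; rewrite ltW ?mesh_gt0// mesh_le.
have [cr cb] := cvg_crossing_bound rho v T0 r01 cq.
have cP := nondecreasing_cvg_mu (mu := P) (fun m => measurable_exceed m v (2 ^ m))
  (bigcup_measurable (fun m _ => measurable_exceed m v (2 ^ m))) (exceed_mono v).
rewrite -(cvg_lim _ cP)//.
set L := std_normal_pdf v * _ in cb.
apply: (@le_trans _ _ (2 * joint_tail c v + 2 * L)%:E).
  pose B m := 2 * joint_tail c v + 2 * (2 ^+ m * crossing_bound rho v (acov X 0 (mesh T m))).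
  have cB : (B m)%:E @[m --> \oo] --> (2 * joint_tail c v + 2 * L)%:E.
    apply: cvg_EFin; first exact: nearW.
    by apply: cvgD; [exact: cvg_cst|exact: cvgMr].
  rewrite -(cvg_lim _ cB)//; apply: lee_lim.
  - by apply/cvg_ex; eexists; exact: cP.
  - by apply/cvg_ex; eexists; exact: cB.
  - have r0 : \forall m \near \oo, 0 < acov X 0 (mesh T m) by exact: (cvgr_gt _ cr _ ltr01).
    near=> m; rewrite /B -natrX; apply: exceed_prob => //.
    by near: m.
rewrite lee_fin /joint_bound lerD2l /L.
set t := std_normal_tail _; set S := Num.sqrt (2 * pi); set V := Num.sqrt (fine _).
have -> : 2 * T * std_normal_pdf v * (V / S) * t =
  2 * (std_normal_pdf v * (t * (T * V / S))) by ring.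
apply: ler_wpM2l => //; apply: ler_wpM2l; first exact: std_normal_pdf_ge0.
apply: ler_wpM2l; first exact: std_normal_tail_ge0.
have S0 : 0 < S^-1 by rewrite invr_gt0 sqrtr_gt0 mulr_gt0// pi_gt0.
by rewrite (ler_pM2r S0) (ler_pM2l T0); exact: ler_wsqrtr.
Unshelve. all: end_near. Qed.


(** Continuity of the bound at u from the left: the two tails increase by at most a multiple of
u - v when u is replaced by v. *)
Lemma joint_bound_le_limit u p : 0 < u ->
  (forall v, 0 < v < u -> p <= joint_bound v) -> p <= joint_bound u.
Proof.
move=> u0 H.
pose F v := 2 * (joint_tail c u + (u - v)) +
  2 * T * std_normal_pdf v * (Num.sqrt (fine 'V_P[Z]%E) / Num.sqrt (2 * pi)) *
  (std_normal_tail (c * u) + c * (u - v)).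
have cF : F v @[v --> u^'-] --> joint_bound u.
  apply: cvg_at_left_filter.
  rewrite -[X in _ --> X](_ : F u = _); last by rewrite /F subrr mulr0 !addr0.
  have cuv : u - v @[v --> u] --> u - u by apply: cvgB; [exact: cvg_cst|exact: cvg_id].
  apply: cvgD.
    by apply: cvgMr; apply: cvgD => //; exact: cvg_cst.
  apply: cvgM; last by apply: cvgD; [exact: cvg_cst|exact: cvgMr].
  by apply: cvgMl; apply: cvgMr; exact: continuous_std_normal_pdf.
rewrite -(cvg_lim _ cF)//; apply: limr_ge; first by apply/cvg_ex; eexists; exact: cF.
near=> v.
have v0 : 0 < v by near: v; exact: nbhs_left_gt.
have vu : v < u by near: v; exact: nbhs_left_lt.
have c0 : 0 <= c by [].
apply: (le_trans (H v _)); first by rewrite v0.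
rewrite /joint_bound /F lerD//.
  by rewrite ler_wpM2l//; apply: joint_tailB_le => //; exact: ltW.
apply: ler_wpM2l; first by rewrite !mulr_ge0 ?std_normal_pdf_ge0// ltW.
have -> : c * v = c * u - c * (u - v) by ring.
by apply: std_normal_tailB_le; rewrite mulr_ge0// subr_ge0 ltW.
Unshelve. all: end_near. Qed.

Lemma path_max_exceedance_prob u : 0 < u ->
  (P [set w | (u <= path_max T (fun t => M t w))%R] <= (joint_bound u)%:E)%E.
Proof.
move=> u0; set E := [set w | _].
have mE : measurable E by exact: measurable_path_max_ge.
rewrite -[X in (X <= _)%E]fineK ?fin_num_measure// lee_fin.
apply: joint_bound_le_limit => // v /andP[v0 vu].
rewrite -lee_fin fineK ?fin_num_measure//.
apply: le_trans (grid_exceedance_prob v0); apply: le_measure; rewrite ?inE//.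
  by apply: bigcup_measurable => m _; exact: measurable_exceed.
move=> w /(lt_le_trans vu) h.
have [m [k km gt]] := path_max_gt_grid T0 (@within_continuous_M w) h.
by exists m => //; exists k.
Qed.

End joint_exceedances.

Theorem theorem2 (d : measure_display) (Omega : measurableType d)
    (R : realType) (P : probability Omega R) (T rho : R)
    (X Y : R -> {RV P >-> R})
    (T_gt0 : 0 < T) (rho_itv : -1 < rho < 1)
    (HX : std_C1_stationary_gaussian T X)
    (HY : std_C1_stationary_gaussian T Y)
    (XY_law : same_fdd T X Y)
    (XY_indep : independent_processes T X Y) :
  let X1 : R -> Omega -> R := fun t w => X t w in
  let X2 : R -> Omega -> R :=
    fun t w => rho * X t w + Num.sqrt (1 - rho ^+ 2) * Y t w in
  let c : R := Num.sqrt ((1 - rho) / (1 + rho)) in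
  let dX1 : R -> Omega -> R :=
    fun t w => path_derivative T (fun s => X1 s w) t in
  forall u : R, 0 < u ->
  (P [set w | (u <= path_max T (fun t => Num.min (X1 t w) (X2 t w)))%R]
   <= (2 * \int[lebesgue_measure]_(x in `[u, +oo[)
              (std_normal_pdf x * std_normal_tail (c * x))
       + 2 * T * std_normal_pdf u
         * (Num.sqrt (fine 'V_P[dX1 0%R]%E) / Num.sqrt (2 * pi))
         * std_normal_tail (c * u))%R%:E)%E.
Proof. by move=> X1 X2 c dX1 u u0; exact: path_max_exceedance_prob. Qed.
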